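(* Let $B_n$ denote the $n$-th Bernoulli number. The sequence $\{|B_{2n}|\}_{n\geq 1}$ is infinitely log-monotonic.
   Context: Bernoulli numbers are defined by $\frac{t}{e^t-1}=\sum_{n\ge0}B_n\frac{t^n}{n!}$. For a sequence $(x_n)_{n\ge m}$ of positive reals: it is log-concave (resp. log-convex) if $x_n^2\ge x_{n-1}x_{n+1}$ (resp. $x_n^2\le x_{n-1}x_{n+1}$) for all $n\ge m+1$. The operator $\mathcal R$ sends $(x_n)_{n\ge m}$ to $(x_{n+1}/x_n)_{n\ge m}$. The sequence is log-monotonic of order $k$ if for every integer $r$ with $0\le r\le k-1$, $\mathcal R^r(x_n)$ is log-convex when $r$ is even and log-concave when $r$ is odd. It is infinitely log-monotonic if it is log-monotonic of order $k$ for every integer $k\ge 1$. *)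

(* Defs.v *)
From Stdlib Require Import Reals Lra Lia Arith.
From Coquelicot Require Import Coquelicot.
Open Scope R_scope.

(* t / (e^t - 1) = sum_n B_n t^n / n! on some punctured neighbourhood of 0.
   The point t = 0 is left out because t / (exp t - 1) there is the junk
   value 0 / 0.  Exactly one B satisfies this: bernoulli_numbers_exist and
   bernoulli_numbers_unique below. *)
Definition bernoulli_numbers (B : nat -> R) : Prop :=
  exists rho : R, 0 < rho /\
    forall t : R, 0 < Rabs t < rho ->
      is_series (fun n : nat => B n * (t ^ n / INR (fact n))) (t / (exp t - 1)).

(* A sequence (x_n)_{n >= m} is a total function x : nat -> R together with
   m; the values below m are irrelevant. *)
Definition positive_seq (m : nat) (x : nat -> R) : Prop :=
  forall n : nat, (m <= n)%nat -> 0 < x n.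

Definition log_concave (m : nat) (x : nat -> R) : Prop :=
  forall n : nat, (m + 1 <= n)%nat -> x n ^ 2 >= x (n - 1)%nat * x (n + 1)%nat.

Definition log_convex (m : nat) (x : nat -> R) : Prop :=
  forall n : nat, (m + 1 <= n)%nat -> x n ^ 2 <= x (n - 1)%nat * x (n + 1)%nat.

Definition ratio_op (x : nat -> R) : nat -> R :=
  fun n : nat => x (n + 1)%nat / x n.

Definition log_monotonic (m k : nat) (x : nat -> R) : Prop :=
  positive_seq m x /\
  forall r : nat, (r < k)%nat ->
    (Nat.Even r -> log_convex m (Nat.iter r ratio_op x)) /\
    (Nat.Odd r -> log_concave m (Nat.iter r ratio_op x)).

Definition infinitely_log_monotonic (m : nat) (x : nat -> R) : Prop :=
  forall k : nat, (1 <= k)%nat -> log_monotonic m k x.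

Fixpoint recip_table (n : nat) : nat -> R :=
  match n with
  | O => fun _ => 1
  | S p => fun k =>
      if le_dec k p then recip_table p k
      else - sum_f_R0 (fun j => recip_table p j * / INR (fact (S (S p - j)))) p
  end.

(* Coefficients of the reciprocal of sum_n t^n / (n+1)!. *)
Definition recip_coef (n : nat) : R := recip_table n n.

Lemma recip_tableE (n k : nat) : (k <= n)%nat -> recip_table n k = recip_coef k.
Proof.
induction n as [|n IH]; intros Hk.
- now replace k with 0%nat by lia.
- destruct (Nat.eq_dec k (S n)) as [->|Hne]; [reflexivity|].
  simpl; destruct (le_dec k n) as [H|H]; [now apply IH | lia].
Qed.

Lemma recip_coefS (n : nat) :
  recip_coef (S n) =
  - sum_f_R0 (fun j => recip_coef j * / INR (fact (S (S n - j)))) n.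
Proof.
unfold recip_coef at 1.
change (recip_table (S n) (S n)) with
  (if le_dec (S n) n then recip_table n (S n)
   else - sum_f_R0 (fun j => recip_table n j * / INR (fact (S (S n - j)))) n).
destruct (le_dec (S n) n) as [H|_]; [lia|].
f_equal; apply sum_eq; intros i Hi; now rewrite recip_tableE.
Qed.

Lemma inv_fact_le (j : nat) : 0 < / INR (fact (S j)) <= (/ 2) ^ j.
Proof.
assert (Hp : forall m, 0 < INR (fact m)).
{ intros m; apply lt_0_INR, lt_O_fact. }
split; [apply Rinv_0_lt_compat, Hp|].
induction j as [|j IH]; [simpl; lra|].
rewrite fact_simpl, mult_INR, Rinv_mult.
change ((/ 2) ^ S j) with (/ 2 * (/ 2) ^ j).
apply Rmult_le_compat; try exact IH.
- left; apply Rinv_0_lt_compat, lt_0_INR; lia.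
- left; apply Rinv_0_lt_compat, Hp.
- apply Rinv_le_contravar; [lra|]. rewrite !S_INR. pose proof (pos_INR j); lra.
Qed.

Lemma half_sum_le (n : nat) : sum_f_R0 (fun k => (/ 2) ^ (S n - k)) n <= 1.
Proof.
induction n as [|n IH]; [simpl; lra|].
rewrite tech5.
replace (S (S n) - S n)%nat with 1%nat by lia.
rewrite (sum_eq _ (fun k => (/ 2) ^ (S n - k) * / 2)).
- rewrite <- scal_sum; simpl pow at 2; lra.
- intros i Hi. replace (S (S n) - i)%nat with (S (S n - i)) by lia. simpl; ring.
Qed.

Lemma recip_coef_bound (n : nat) : Rabs (recip_coef n) <= 1.
Proof.
induction n as [n IH] using (well_founded_induction lt_wf).
destruct n as [|n]; [unfold recip_coef; simpl; rewrite Rabs_R1; lra|].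
rewrite recip_coefS, Rabs_Ropp.
eapply Rle_trans; [apply sum_f_R0_triangle|].
eapply Rle_trans; [|apply (half_sum_le n)].
apply sum_Rle; intros k Hk.
rewrite Rabs_mult.
pose proof (inv_fact_le (S n - k)) as [H1 H2].
rewrite (Rabs_pos_eq (/ _)) by lra.
pose proof (IH k ltac:(lia)). pose proof (Rabs_pos (recip_coef k)).
replace ((/ 2) ^ (S n - k)) with (1 * (/ 2) ^ (S n - k)) by ring.
apply Rmult_le_compat; lra.
Qed.

Lemma CV_radius_ge1 (a : nat -> R) (x : R) :
  (forall n, Rabs (a n) <= 1) -> Rabs x < 1 ->
  Rbar_lt (Finite (Rabs x)) (CV_radius a).
Proof.
intros Ha Hx.
apply Rbar_lt_le_trans with (Finite 1); [exact Hx|].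
apply (proj1 (CV_radius_bounded a) 1).
exists 1; intros n. rewrite pow1, Rmult_1_r. apply Ha.
Qed.

Lemma bernoulli_numbers_exist : exists B : nat -> R, bernoulli_numbers B.
Proof.
exists (fun n => recip_coef n * INR (fact n)).
exists 1; split; [lra|]; intros t [Ht0 Ht1].
assert (Htn : t <> 0) by (intros ->; rewrite Rabs_R0 in Ht0; lra).
assert (Hen : exp t - 1 <> 0).
{ intros H; apply Htn, exp_inv; rewrite exp_0; lra. }
set (b := fun n => / INR (fact (S n))).
assert (Hb : is_pseries b t ((exp t - 1) / t)).
{ pose proof (is_pseries_decr_1 (fun n => / INR (fact n)) t (/ t) (exp t)
    ltac:(exact (Rinv_l _ Htn)) (is_exp_Reals t)) as H.
  unfold PS_decr_1 in H.
  replace ((exp t - 1) / t) with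
    (scal (/ t) (plus (exp t) (opp (/ INR (fact 0))))); [exact H|].
  unfold scal, plus, opp; simpl; unfold mult; simpl; field; exact Htn. }
assert (Rb : Rbar_lt (Finite (Rabs t)) (CV_radius b)).
{ apply CV_radius_ge1; [intros n|exact Ht1].
  unfold b; pose proof (inv_fact_le n) as [H1 H2].
  rewrite Rabs_pos_eq by lra.
  eapply Rle_trans; [exact H2|].
  rewrite <- (pow1 n); apply pow_incr; lra. }
assert (Ra : Rbar_lt (Finite (Rabs t)) (CV_radius recip_coef)).
{ apply CV_radius_ge1; [exact recip_coef_bound|exact Ht1]. }
assert (Ha : is_pseries recip_coef t (PSeries recip_coef t)).
{ apply PSeries_correct, CV_radius_inside, Ra. }
pose proof (is_pseries_mult _ _ _ _ _ Ha Hb Ra Rb) as Hm.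
assert (Hone : PSeries (PS_mult recip_coef b) t = 1).
{ rewrite PSeries_decr_1 by (eexists; exact Hm).
  rewrite (PSeries_ext _ (fun _ => 0)).
  - rewrite PSeries_const_0. unfold PS_mult, recip_coef, b; simpl; field.
  - intros n; unfold PS_decr_1, PS_mult. rewrite tech5, recip_coefS.
    replace (S n - S n)%nat with 0%nat by lia.
    replace (b 0%nat) with 1 by (unfold b; simpl; field). unfold b; ring. }
rewrite (is_pseries_unique _ _ _ Hm) in Hone.
replace (t / (exp t - 1)) with (PSeries recip_coef t).
- eapply is_series_ext; [|exact Ha]. intros n; simpl.
  unfold scal; simpl; unfold mult; simpl. rewrite pow_n_pow.
  field. apply INR_fact_neq_0.
- apply Rmult_eq_reg_r with ((exp t - 1) / t).
  + rewrite Hone; field; auto.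
  + intros H; rewrite H in Hone; lra.
Qed.

Lemma bernoulli_numbers_pseries (B : nat -> R) :
  bernoulli_numbers B ->
  let a := fun n => B n / INR (fact n) in
  Rbar_lt (Finite 0) (CV_radius a) /\
  exists rho : R, 0 < rho /\
    forall t : R, 0 < Rabs t < rho -> PSeries a t = t / (exp t - 1).
Proof.
intros [rho [Hrho HB]] a.
assert (Ha : forall t, 0 < Rabs t < rho -> is_pseries a t (t / (exp t - 1))).
{ intros t Ht. apply is_pseries_R.
  eapply is_series_ext; [|exact (HB t Ht)]. intros n; unfold a; simpl.
  field. apply INR_fact_neq_0. }
split.
- assert (Hh : Rabs (rho / 2) = rho / 2) by (apply Rabs_pos_eq; lra).
  assert (Ht : 0 < Rabs (rho / 2) < rho) by lra.
  apply Rbar_lt_le_trans with (Finite (Rabs (rho / 2))); [exact (proj1 Ht)|].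
  apply Rbar_not_lt_le; intros Hlt.
  apply (CV_disk_outside _ _ Hlt).
  eapply is_lim_seq_ext; [|apply ex_series_lim_0; eexists; exact (HB _ Ht)].
  intros n; unfold a; simpl. field. apply INR_fact_neq_0.
- exists rho; split; [exact Hrho|]. intros t Ht. now apply is_pseries_unique, Ha.
Qed.

Lemma bernoulli_numbers_unique (B C : nat -> R) :
  bernoulli_numbers B -> bernoulli_numbers C -> forall n : nat, B n = C n.
Proof.
intros HB HC n.
destruct (bernoulli_numbers_pseries B HB) as [RB [r1 [Hr1 EB]]].
destruct (bernoulli_numbers_pseries C HC) as [RC [r2 [Hr2 EC]]].
set (b := fun n => B n / INR (fact n)) in *.
set (c := fun n => C n / INR (fact n)) in *.
assert (Hr : 0 < Rmin r1 r2) by (apply Rmin_pos; assumption).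
assert (E : forall t, 0 < Rabs t < Rmin r1 r2 -> PSeries b t = PSeries c t).
{ intros t Ht. pose proof (Rmin_l r1 r2); pose proof (Rmin_r r1 r2).
  rewrite EB, EC; lra. }
assert (Hcont : continuity_pt (fun t => PSeries b t - PSeries c t) 0).
{ apply continuity_pt_minus; apply PSeries_continuity; now rewrite Rabs_R0. }
assert (E0 : PSeries b 0 = PSeries c 0).
{ apply Rminus_diag_uniq.
  destruct (Req_dec (PSeries b 0 - PSeries c 0) 0) as [H|H]; [exact H|exfalso].
  destruct (Hcont _ (Rabs_pos_lt _ H)) as [d [Hd Hc]].
  set (t := Rmin d (Rmin r1 r2) / 2).
  pose proof (Rmin_pos _ _ Hd Hr).
  pose proof (Rmin_l d (Rmin r1 r2)); pose proof (Rmin_r d (Rmin r1 r2)).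
  assert (Ht : 0 < t) by (unfold t; lra).
  assert (At : Rabs t = t) by (apply Rabs_pos_eq; lra).
  specialize (Hc t); simpl in Hc; unfold R_dist in Hc.
  rewrite (E t) in Hc by (rewrite At; unfold t in *; lra).
  rewrite Rminus_diag, Rminus_0_l, Rabs_Ropp in Hc.
  apply (Rlt_irrefl (Rabs (PSeries b 0 - PSeries c 0))), Hc.
  split; [split; [exact I|lra]|].
  rewrite Rminus_0_r, At; unfold t; lra. }
assert (Hn : b n = c n).
{ apply PSeries_ext_recip; try assumption.
  exists (mkposreal _ Hr); intros t Ht.
  destruct (Req_dec t 0) as [->|Hne]; [exact E0|].
  apply E; split; [now apply Rabs_pos_lt|].
  revert Ht; unfold ball; simpl; unfold AbsRing_ball, abs, minus, plus, opp; simpl.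
  now rewrite Ropp_0, Rplus_0_r. }
unfold b, c in Hn.
apply (Rmult_eq_reg_r (/ INR (fact n))); [exact Hn|].
apply Rinv_neq_0_compat, INR_fact_neq_0.
Qed.

(* Main.v *)
Require Import Defs.
From Stdlib Require Import Reals Lra Lia Arith List Bool.
From Coquelicot Require Import Coquelicot.
Open Scope R_scope.

(** Log-monotonicity of every order means that
    [(-1)^k Delta^k (ln |B_2n|) >= 0] for all [k >= 2].  By Euler's formula
    [|B_2n| = 2 (2n)! zeta(2n) / (2 pi)^2n] it suffices to treat [ln (2n)!] and
    [ln zeta(2n)], the rest being affine in [n].  By the mean value theorem
    [Delta^(j+1) G (x) = Delta^j G' (xi)], so both reduce to complete monotonicity
    of derivatives: that of [ln (x + c)] is [1 / (x + c)], and the Euler product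
    writes [ln zeta(2x)] as a sum of functions [- ln (1 - exp (- a x))], whose
    derivatives are minus geometric series of decaying exponentials.

    Euler's formula comes from the partial fractions of the cotangent, the limit
    of [N cot x = sum_(k < N) cot ((x + k pi) / N)] along [N = 2^n]; comparing the
    power series of [x cot x] with [cos] and [sin] gives a recursion on its
    coefficients, and flipping signs turns it into the one for [u coth u], hence
    for [t / (e^t - 1) = u coth u - u] with [t = 2 u].  Tannery's theorem
    (dominated convergence for series) justifies all interchanges of limits. *)

(** * Dominated convergence for series *)

Lemma is_lim_seq_sum_0 (d : nat -> nat -> R) (K : nat) :
  (forall k, is_lim_seq (fun n => d n k) 0) ->
  is_lim_seq (fun n => sum_f_R0 (d n) K) 0.
Proof.
intros Hd; induction K as [|K IH]; simpl; [apply Hd|].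
replace (Finite 0) with (Finite (0 + 0)) by (f_equal; ring).
apply is_lim_seq_plus'; [exact IH|apply Hd].
Qed.

Lemma is_lim_seq_eps (u : nat -> R) (l : R) :
  (forall eps, 0 < eps -> exists N, forall n, (N <= n)%nat -> Rabs (u n - l) < eps) ->
  is_lim_seq u l.
Proof.
intros H. apply is_lim_seq_Reals. intros eps Heps.
destruct (H eps Heps) as [N HN]. exists N; intros n Hn. now apply HN.
Qed.

Lemma is_lim_seq_eps_elim (u : nat -> R) (l eps : R) :
  is_lim_seq u l -> 0 < eps ->
  exists N, forall n, (N <= n)%nat -> Rabs (u n - l) < eps.
Proof.
intros H Heps. apply is_lim_seq_Reals in H.
destruct (H eps Heps) as [N HN]. exists N; intros n Hn. now apply HN.
Qed.

Lemma ex_series_dominated (a M : nat -> R) :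
  ex_series M -> (forall k, Rabs (a k) <= M k) -> ex_series a.
Proof. intros HM Ha. exact (ex_series_le (V := R_CompleteNormedModule) a M Ha HM). Qed.

(** Beyond a cut-off [K] the terms [|a n k - b k|] are controlled by the tail of [2 * M], uniformly
    in [n]; the finitely many terms up to [K] tend to 0. *)
Lemma tannery (a : nat -> nat -> R) (b M : nat -> R) :
  ex_series M -> (forall n k, Rabs (a n k) <= M k) ->
  (forall k, is_lim_seq (fun n => a n k) (b k)) ->
  ex_series b /\ is_lim_seq (fun n => Series (a n)) (Series b).
Proof.
intros HM Ha Hlim.
assert (Hb : forall k, Rabs (b k) <= M k).
{ intros k.
  exact (is_lim_seq_le (fun n => Rabs (a n k)) (fun _ => M k)
    (Rabs (b k)) (M k) (fun n => Ha n k)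
    (is_lim_seq_abs _ _ (Hlim k)) (is_lim_seq_const _)). }
assert (Eb : ex_series b) by exact (ex_series_dominated _ _ HM Hb).
split; [exact Eb|].
set (d := fun n k => Rabs (a n k - b k)).
assert (Hd : forall n k, 0 <= d n k <= 2 * M k).
{ intros n k; unfold d; split; [apply Rabs_pos|].
  pose proof (Rabs_triang (a n k) (- b k)). rewrite Rabs_Ropp in H.
  specialize (Ha n k); specialize (Hb k). unfold Rminus; lra. }
assert (E2 : ex_series (fun k => 2 * M k)) by exact (ex_series_scal_l 2 M HM).
assert (Ed : forall n, ex_series (d n)).
{ intros n; apply (ex_series_dominated _ _ E2).
  intros k; rewrite Rabs_pos_eq; apply Hd. }
assert (Hle : forall n, Rabs (Series (a n) - Series b) <= Series (d n)).
{ intros n. rewrite <- Series_minus; [|exact (ex_series_dominated _ _ HM (Ha n))|exact Eb].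
  apply Series_Rabs, Ed. }
apply is_lim_seq_eps; intros eps Heps.
destruct (is_lim_seq_eps_elim _ _ (eps / 2) (Series_correct _ E2) ltac:(lra)) as [K HK].
specialize (HK K (le_n K)).
assert (Hd0 : is_lim_seq (fun n => sum_f_R0 (d n) K) 0).
{ apply is_lim_seq_sum_0; intros k. apply -> is_lim_seq_abs_0.
  replace (Finite 0) with (Finite (b k - b k)) by (f_equal; ring).
  apply is_lim_seq_minus'; [apply Hlim|apply is_lim_seq_const]. }
destruct (is_lim_seq_eps_elim _ _ (eps / 2) Hd0 ltac:(lra)) as [N HN].
exists N; intros n Hn. specialize (HN n Hn).
eapply Rle_lt_trans; [apply Hle|].
rewrite sum_n_Reals in HK.
rewrite (Series_incr_n _ (S K) ltac:(lia) E2) in HK.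
rewrite (Series_incr_n _ (S K) ltac:(lia) (Ed n)). simpl pred in *.
assert (Ht : Series (fun k => d n (S K + k)%nat) <= Series (fun k => 2 * M (S K + k)%nat)).
{ apply Series_le; [intros k; apply Hd|].
  apply (ex_series_incr_n (fun k => 2 * M k) (S K)), E2. }
apply Rabs_def2 in HN; apply Rabs_def2 in HK. lra.
Qed.

(** * The zeta series and the exchange of summations *)

(** Telescoping: 1/(x+1)^2 <= 1/x - 1/(x+1). *)
Lemma sum_inv_sqr_le (n : nat) :
  sum_f_R0 (fun k => / INR (S k) ^ 2) n <= 2 - / INR (S n).
Proof.
induction n as [|n IH]; [simpl; lra|].
rewrite tech5. apply Rle_trans with (2 - / INR (S n) + / INR (S (S n)) ^ 2); [lra|].
rewrite (S_INR (S n)). set (x := INR (S n)).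
assert (Hx : 0 < x) by (apply lt_0_INR; lia).
cut (0 <= / x - / (x + 1) - / (x + 1) ^ 2); [lra|].
replace (/ x - / (x + 1) - / (x + 1) ^ 2) with (/ (x * (x + 1) ^ 2)) by (field; lra).
left; apply Rinv_0_lt_compat, Rmult_lt_0_compat; [lra|apply pow_lt; lra].
Qed.

Lemma ex_series_inv_sqr : ex_series (fun k => / INR (S k) ^ 2).
Proof.
destruct (ex_finite_lim_seq_incr (sum_n (fun k => / INR (S k) ^ 2)) 2) as [l Hl].
- intros n. rewrite sum_Sn.
  assert (0 < / INR (S (S n)) ^ 2)
    by (apply Rinv_0_lt_compat, pow_lt, lt_0_INR; lia).
  unfold plus; cbn -[INR pow]. lra.
- intros n; rewrite sum_n_Reals. pose proof (sum_inv_sqr_le n).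
  assert (0 < / INR (S n)) by (apply Rinv_0_lt_compat, lt_0_INR; lia). lra.
- exists l; exact Hl.
Qed.

Definition zeta (s : nat) : R := Series (fun k => / INR (S k) ^ s).

Lemma inv_pow_bound (s k : nat) :
  (2 <= s)%nat -> 0 < / INR (S k) ^ s <= / INR (S k) ^ 2.
Proof.
intros Hs. assert (H1 : 1 <= INR (S k)) by (rewrite S_INR; pose proof (pos_INR k); lra).
split; [apply Rinv_0_lt_compat, pow_lt; lra|].
apply Rinv_le_contravar; [apply pow_lt; lra|now apply Rle_pow].
Qed.

Lemma ex_series_zeta (s : nat) : (2 <= s)%nat -> ex_series (fun k => / INR (S k) ^ s).
Proof.
intros Hs. apply (ex_series_dominated _ _ ex_series_inv_sqr).
intros k; pose proof (inv_pow_bound s k Hs). rewrite Rabs_pos_eq; lra.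
Qed.

Lemma series_finite_swap (a : nat -> nat -> R) (J : nat) :
  (forall j, ex_series (a j)) ->
  is_series (fun k => sum_f_R0 (fun j => a j k) J) (sum_f_R0 (fun j => Series (a j)) J).
Proof.
intros Ha; induction J as [|J IH]; simpl.
- apply Series_correct, Ha.
- apply (is_series_plus (V := R_NormedModule)); [exact IH|apply Series_correct, Ha].
Qed.

(** Tonelli for nonnegative terms: the partial sums over [j] increase to [b k], hence are dominated
    by it, and Tannery's theorem applies to them. *)
Lemma series_swap (a : nat -> nat -> R) (b : nat -> R) :
  (forall j k, 0 <= a j k) -> (forall k, is_series (fun j => a j k) (b k)) ->
  ex_series b -> is_series (fun j => Series (a j)) (Series b).
Proof.
intros Hpos Hk Hb.
assert (Hsum : forall J k, 0 <= sum_f_R0 (fun j => a j k) J <= b k).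
{ intros J k; split; [apply cond_pos_sum; intros; apply Hpos|].
  apply sum_incr; [|intros; apply Hpos].
  apply is_lim_seq_Reals.
  eapply is_lim_seq_ext; [|exact (Hk k)]. intros n; apply sum_n_Reals. }
assert (Hle : forall j k, Rabs (a j k) <= b k).
{ intros j k. rewrite Rabs_pos_eq by apply Hpos.
  destruct j as [|j]; [apply (Hsum 0%nat k)|].
  pose proof (Hsum j k). pose proof (proj2 (Hsum (S j) k)). rewrite tech5 in H0. lra. }
destruct (tannery (fun J k => sum_f_R0 (fun j => a j k) J) b b Hb) as [_ H].
- intros J k; rewrite Rabs_pos_eq; apply Hsum.
- intros k. eapply is_lim_seq_ext; [|exact (Hk k)]. intros n; apply sum_n_Reals.
- change (is_lim_seq (sum_n (fun j => Series (a j))) (Series b)).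
  eapply is_lim_seq_ext; [|exact H]. intros J; simpl. rewrite sum_n_Reals.
  apply is_series_unique, series_finite_swap.
  intros j. exact (ex_series_dominated _ _ Hb (Hle j)).
Qed.

(** * The Euler product *)

(** Summing over n = 1, ..., N on the left gives the first N / p terms on the right, so the partial
    sums on the right form a subsequence of those on the left. *)
Lemma series_multiples (f : nat -> R) (p : nat) :
  (1 <= p)%nat -> (forall n, 0 <= f n) -> ex_series (fun k => f (S k)) ->
  Series (fun k => if (S k mod p =? 0)%nat then f (S k) else 0)
  = Series (fun k => f (p * S k)%nat).
Proof.
intros Hp Hf Hex.
set (g := fun k => if (S k mod p =? 0)%nat then f (S k) else 0).
set (h := fun k => f (p * S k)%nat).
set (H := fun c => match c with O => 0 | S m => sum_f_R0 h m end).
assert (HS : forall c, H (S c) = H c + h c).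
{ intros [|c]; simpl; [ring|reflexivity]. }
assert (Hg : forall n, sum_f_R0 g n = H (S n / p)%nat).
{ assert (Hstep : forall n, H (S n / p)%nat = H (n / p)%nat + g n).
  { intros n. unfold g.
    pose proof (Nat.div_mod_eq n p) as E1. pose proof (Nat.div_mod_eq (S n) p) as E2.
    pose proof (Nat.mod_upper_bound n p ltac:(lia)).
    pose proof (Nat.mod_upper_bound (S n) p ltac:(lia)).
    destruct (Nat.eqb_spec (S n mod p) 0) as [E|E].
    - assert (Ed : (S n / p = S (n / p))%nat) by nia.
      rewrite Ed, HS. unfold h. rewrite <- Ed.
      now replace (p * (S n / p))%nat with (S n) by lia.
    - assert (Ed : (S n / p = n / p)%nat) by nia.
      rewrite Ed; ring. }
  induction n as [|n IH].
  - rewrite Hstep. rewrite Nat.Div0.div_0_l. simpl; ring.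
  - rewrite Hstep, <- IH. reflexivity. }
assert (Hex' : ex_series g).
{ apply (ex_series_dominated _ _ Hex). intros k; unfold g.
  destruct (_ =? _)%nat; [rewrite Rabs_pos_eq; [lra|apply Hf]|].
  rewrite Rabs_R0; apply Hf. }
symmetry. apply is_series_unique.
change (is_lim_seq (sum_n h) (Series g)).
apply is_lim_seq_ext with (fun m => sum_n g (p * S m - 1)).
- intros m. rewrite !sum_n_Reals, Hg.
  replace (S (p * S m - 1)) with (S m * p)%nat by nia.
  now rewrite Nat.div_mul by lia.
- apply (is_lim_seq_subseq (sum_n g) (Series g) (fun m => p * S m - 1)%nat).
  + apply eventually_subseq. intros n; nia.
  + exact (Series_correct _ Hex').
Qed.

(** Whether [n] survives the sieve of Eratosthenes by 2, ..., [N]; every [n] does when [N <= 1]. *)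
Definition roughb (N n : nat) : bool :=
  forallb (fun d => negb (n mod d =? 0)%nat) (seq 2 (N - 1)).

Lemma roughb_spec (N n : nat) :
  roughb N n = true <-> forall d, (2 <= d <= N)%nat -> ~ Nat.divide d n.
Proof.
unfold roughb. rewrite forallb_forall. split; intros H d Hd.
- specialize (H d). rewrite in_seq in H. specialize (H ltac:(lia)).
  rewrite negb_true_iff, Nat.eqb_neq in H. intros Hdiv.
  now apply H, Nat.Lcm0.mod_divide.
- rewrite in_seq in Hd. rewrite negb_true_iff, Nat.eqb_neq. intros E.
  apply (H d); [lia|]. apply Nat.Lcm0.mod_divide, E.
Qed.

Lemma roughb_1 (N : nat) : roughb N 1 = true.
Proof.
apply roughb_spec. intros d Hd Hdiv.
apply Nat.divide_1_r in Hdiv; lia.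
Qed.

Lemma roughb_small (N n : nat) : (2 <= n <= N)%nat -> roughb N n = false.
Proof.
intros H. apply not_true_is_false. rewrite roughb_spec. intros Hn.
apply (Hn n H), Nat.divide_refl.
Qed.

Lemma roughb_S (N n : nat) :
  (1 <= N)%nat -> roughb (S N) n = roughb N n && negb (n mod (S N) =? 0)%nat.
Proof.
intros HN. unfold roughb. replace (S N - 1)%nat with (S (N - 1)) by lia.
rewrite seq_S, forallb_app. cbn [forallb]. rewrite andb_true_r.
now replace (2 + (N - 1))%nat with (S N) by lia.
Qed.

(** Here [N + 1] is prime, so any [d] with 2 <= d <= N is coprime to it, and Gauss's lemma moves
    divisibility from the product to [n]. *)
Lemma roughb_mul (N n : nat) :
  (1 <= N)%nat -> roughb N (S N) = true -> roughb N (S N * n) = roughb N n.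
Proof.
intros HN Hp. rewrite roughb_spec in Hp.
apply eq_true_iff_eq. rewrite !roughb_spec. split; intros H d Hd Hdiv; apply (H d Hd).
- now apply Nat.divide_mul_r.
- apply (Nat.gauss d (S N) n Hdiv).
  assert (Hg : Nat.divide (Nat.gcd d (S N)) d) by apply Nat.gcd_divide_l.
  apply Nat.divide_pos_le in Hg; [|lia].
  assert (Nat.gcd d (S N) <> 0)%nat by (rewrite Nat.gcd_eq_0; lia).
  destruct (Nat.eq_dec (Nat.gcd d (S N)) 1) as [E|E]; [exact E|].
  exfalso. apply (Hp (Nat.gcd d (S N))); [lia|apply Nat.gcd_divide_r].
Qed.

(** A composite [N + 1] has a divisor in 2, ..., [N], so its multiples have already been sieved
    out. *)
Lemma roughb_composite (N n : nat) :
  (1 <= N)%nat -> roughb N (S N) = false -> roughb (S N) n = roughb N n.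
Proof.
intros HN Hp. rewrite roughb_S by exact HN.
destruct (roughb N n) eqn:Hn; [|reflexivity].
destruct (Nat.eqb_spec (n mod S N) 0) as [E|E]; [exfalso|reflexivity].
apply Nat.Lcm0.mod_divide in E.
apply not_true_iff_false in Hp; apply Hp. rewrite roughb_spec in *.
intros d Hd Hdiv. apply (Hn d Hd). now apply Nat.divide_trans with (S N).
Qed.

Definition rough_term (N s n : nat) : R := if roughb N n then / INR n ^ s else 0.

Definition rough_zeta (N s : nat) : R := Series (fun k => rough_term N s (S k)).

(* The factor [1 - p^-s] when [p = N + 1] is prime, and [1] otherwise: [N + 1]
   is prime exactly when it is [N]-rough. *)
Definition euler_factor (N s : nat) : R :=
  if roughb N (S N) then 1 - / INR (S N) ^ s else 1.

Lemma rough_term_bound (N s k : nat) :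
  (2 <= s)%nat -> 0 <= rough_term N s (S k) <= / INR (S k) ^ 2.
Proof.
intros Hs; unfold rough_term. pose proof (inv_pow_bound s k Hs).
destruct (roughb _ _); lra.
Qed.

Lemma ex_series_rough (N s : nat) : (2 <= s)%nat -> ex_series (fun k => rough_term N s (S k)).
Proof.
intros Hs. apply (ex_series_dominated _ _ ex_series_inv_sqr).
intros k; pose proof (rough_term_bound N s k Hs). rewrite Rabs_pos_eq; lra.
Qed.

(** The sieve step. For a prime p = N + 1 the rough multiples of p are p times the rough numbers, so
    removing them subtracts p^-s times the whole series. *)
Lemma rough_zeta_S (N s : nat) :
  (1 <= N)%nat -> (2 <= s)%nat ->
  rough_zeta (S N) s = euler_factor N s * rough_zeta N s.
Proof.
intros HN Hs. unfold euler_factor.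
destruct (roughb N (S N)) eqn:Hp.
(* Index 0 gets the value 0, since [rough_term] there may be the inverse of [0 ^ s]. *)
- set (f := fun n => match n with O => 0 | S k => rough_term N s (S k) end).
  assert (Hf : forall n, 0 <= f n).
  { intros [|n]; [apply Rle_refl|apply (rough_term_bound N s n Hs)]. }
  pose proof (series_multiples f (S N) ltac:(lia) Hf (ex_series_rough N s Hs)) as Hm.
  assert (E1 : Series (fun k => f (S N * S k)%nat) = / INR (S N) ^ s * rough_zeta N s).
  { unfold rough_zeta. rewrite <- Series_scal_l. apply Series_ext. intros k.
    unfold f. destruct (S N * S k)%nat eqn:E; [lia|]. rewrite <- E.
    unfold rough_term. rewrite roughb_mul by assumption.
    destruct (roughb N (S k)); [|ring].
    rewrite mult_INR, Rpow_mult_distr, Rinv_mult. reflexivity. }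
  rewrite E1 in Hm.
  replace ((1 - / INR (S N) ^ s) * rough_zeta N s)
    with (rough_zeta N s - / INR (S N) ^ s * rough_zeta N s) by ring.
  rewrite <- Hm. unfold rough_zeta at 2. rewrite <- Series_minus.
  + apply Series_ext. intros k. unfold f, rough_term.
    rewrite roughb_S by exact HN.
    destruct (roughb N (S k)), (S k mod S N =? 0)%nat; simpl; ring.
  + now apply ex_series_rough.
  + apply (ex_series_dominated _ _ (ex_series_rough N s Hs)). intros k.
    pose proof (rough_term_bound N s k Hs). unfold f.
    destruct (_ =? _)%nat; [rewrite Rabs_pos_eq|rewrite Rabs_R0]; lra.
- rewrite Rmult_1_l. apply Series_ext. intros k. unfold rough_term.
  now rewrite roughb_composite.
Qed.

Lemma series_first : is_series (fun k => match k with O => 1 | S _ => 0 end) 1.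
Proof.
change (is_lim_seq (sum_n (fun k => match k with O => 1 | S _ => 0 end)) 1).
apply is_lim_seq_ext with (fun _ => 1); [|apply is_lim_seq_const].
intros n; rewrite sum_n_Reals. induction n as [|n IH]; [reflexivity|].
rewrite tech5, <- IH; ring.
Qed.

Lemma zeta_ge_1 (s : nat) : (2 <= s)%nat -> 1 <= zeta s.
Proof.
intros Hs. rewrite <- (is_series_unique _ _ series_first).
apply Series_le; [|now apply ex_series_zeta].
intros [|k].
- rewrite INR_1, pow1, Rinv_1; lra.
- pose proof (inv_pow_bound s (S k) Hs); lra.
Qed.

Lemma rough_zeta_1 (s : nat) : rough_zeta 1 s = zeta s.
Proof. reflexivity. Qed.

(** Each n >= 2 is sieved out once N >= n, so only the term at n = 1 survives in the limit;
    [1 / n^2] dominates. *)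
Lemma rough_zeta_lim (s : nat) : (2 <= s)%nat -> is_lim_seq (fun N => rough_zeta N s) 1.
Proof.
intros Hs. rewrite <- (is_series_unique _ _ series_first).
apply (tannery (fun N k => rough_term N s (S k)) _ _ ex_series_inv_sqr).
- intros N k; pose proof (rough_term_bound N s k Hs). rewrite Rabs_pos_eq; lra.
- intros [|k].
  + apply is_lim_seq_ext with (fun _ => 1); [|apply is_lim_seq_const].
    intros N; unfold rough_term. rewrite roughb_1, INR_1, pow1, Rinv_1; reflexivity.
  + apply is_lim_seq_ext_loc with (fun _ => 0); [|apply is_lim_seq_const].
    exists (S (S k)). intros N HN; unfold rough_term.
    rewrite roughb_small by lia. reflexivity.
Qed.

Lemma euler_factor_pos (N s : nat) : (1 <= N)%nat -> (1 <= s)%nat -> 0 < euler_factor N s.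
Proof.
intros HN Hs; unfold euler_factor. destruct (roughb _ _); [|lra].
assert (H2 : 1 < INR (S N)) by (apply (lt_INR 1); lia).
assert (H : / INR (S N) ^ s < 1); [|lra].
rewrite <- Rinv_1. apply Rinv_lt_contravar; [rewrite Rmult_1_l; apply pow_lt; lra|].
apply Rlt_pow_R1; [exact H2|lia].
Qed.

(** Iterates the sieve step from [rough_zeta 1 s = zeta s]; the factor [euler_factor (S i)] belongs
    to the sieving number i + 2. *)
Lemma ln_rough_zeta (s K : nat) :
  (2 <= s)%nat ->
  0 < rough_zeta (S (S K)) s /\
  ln (rough_zeta (S (S K)) s) =
  ln (zeta s) - sum_f_R0 (fun i => - ln (euler_factor (S i) s)) K.
Proof.
intros Hs. pose proof (zeta_ge_1 s Hs).
induction K as [|K [IH1 IH2]]; rewrite rough_zeta_S by lia.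
- pose proof (euler_factor_pos 1 s ltac:(lia) ltac:(lia)).
  rewrite rough_zeta_1. split; [apply Rmult_lt_0_compat; lra|].
  rewrite ln_mult by lra. simpl; ring.
- pose proof (euler_factor_pos (S (S K)) s ltac:(lia) ltac:(lia)).
  split; [apply Rmult_lt_0_compat; lra|].
  rewrite ln_mult, IH2, tech5 by lra. ring.
Qed.

Lemma ln_zeta_euler (s : nat) :
  (2 <= s)%nat ->
  is_lim_seq (fun K => sum_f_R0 (fun i => - ln (euler_factor (S i) s)) K) (ln (zeta s)).
Proof.
intros Hs.
apply is_lim_seq_ext with (fun K => ln (zeta s) - ln (rough_zeta (S (S K)) s)).
{ intros K. rewrite (proj2 (ln_rough_zeta s K Hs)). ring. }
replace (Finite (ln (zeta s))) with (Finite (ln (zeta s) - ln 1))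
  by (rewrite ln_1; f_equal; ring).
apply is_lim_seq_minus'; [apply is_lim_seq_const|].
apply is_lim_seq_continuous.
- apply derivable_continuous_pt. exists (/ 1). apply derivable_pt_lim_ln; lra.
- apply -> (is_lim_seq_incr_1 (fun N => rough_zeta (S N) s)).
  apply -> (is_lim_seq_incr_1 (fun N => rough_zeta N s)).
  apply rough_zeta_lim, Hs.
Qed.

(** * Signs of iterated differences *)

(** Forward differences occur on the reals, where the mean value theorem applies, and as [sdiff] on
    the naturals, where the sequences live. *)
Definition rdiff (f : R -> R) : R -> R := fun x => f (x + 1) - f x.

Definition sdiff (f : nat -> R) : nat -> R := fun n => f (S n) - f n.

Lemma iter_rdiff_plus (f g : R -> R) (j : nat) (x : R) :
  Nat.iter j rdiff (fun y => f y + g y) x = Nat.iter j rdiff f x + Nat.iter j rdiff g x.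
Proof.
revert x; induction j as [|j IH]; intros x; simpl; [reflexivity|].
unfold rdiff at 1. rewrite !IH. unfold rdiff; ring.
Qed.

Lemma iter_rdiff_lim (F : nat -> R -> R) (f : R -> R) (j : nat) (x : R) :
  0 < x -> (forall y, 0 < y -> is_lim_seq (fun K => F K y) (f y)) ->
  is_lim_seq (fun K => Nat.iter j rdiff (F K) x) (Nat.iter j rdiff f x).
Proof.
intros Hx H; revert x Hx; induction j as [|j IH]; intros x Hx; simpl; [now apply H|].
apply is_lim_seq_minus'; apply IH; lra.
Qed.

Lemma iter_rdiff_derive (G g : R -> R) (j : nat) (x : R) :
  0 < x -> (forall y, 0 < y -> is_derive G y (g y)) ->
  is_derive (Nat.iter j rdiff G) x (Nat.iter j rdiff g x).
Proof.
intros Hx H; revert x Hx; induction j as [|j IH]; intros x Hx; simpl; [now apply H|].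
apply (is_derive_minus (fun y => Nat.iter j rdiff G (y + 1)) (Nat.iter j rdiff G));
  [|now apply IH].
replace (Nat.iter j rdiff g (x + 1)) with (scal 1 (Nat.iter j rdiff g (x + 1)))
  by apply Rmult_1_l.
apply (is_derive_comp (Nat.iter j rdiff G) (fun y => y + 1)); [apply IH; lra|].
auto_derive; [exact I|ring].
Qed.

(** Trades one difference for one derivative, by the mean value theorem for the [j]-th difference on
    [x, x+1]. The unknown [xi] is harmless because only signs on the positive half-line are
    wanted. *)
Lemma iter_rdiff_MVT (G g : R -> R) (j : nat) (x : R) :
  0 < x -> (forall y, 0 < y -> is_derive G y (g y)) ->
  exists xi, 0 < xi /\ Nat.iter (S j) rdiff G x = Nat.iter j rdiff g xi.
Proof.
intros Hx H.
destruct (MVT_cor2 (Nat.iter j rdiff G) (Nat.iter j rdiff g) x (x + 1)) as [xi [E Hxi]].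
- lra.
- intros c Hc. apply is_derive_Reals, iter_rdiff_derive; [lra|exact H].
- exists xi; split; [lra|]. simpl; unfold rdiff at 1. rewrite E; ring.
Qed.

Lemma iter_sdiff_INR (f : R -> R) (j n : nat) :
  Nat.iter j sdiff (fun m => f (INR m)) n = Nat.iter j rdiff f (INR n).
Proof.
revert n; induction j as [|j IH]; intros n; simpl; [reflexivity|].
unfold sdiff at 1, rdiff at 1. now rewrite !IH, S_INR.
Qed.

Lemma iter_sdiff_ext (f g : nat -> R) (j n : nat) :
  (1 <= n)%nat -> (forall m, (1 <= m)%nat -> f m = g m) ->
  Nat.iter j sdiff f n = Nat.iter j sdiff g n.
Proof.
intros Hn H; revert n Hn; induction j as [|j IH]; intros n Hn; simpl; [now apply H|].
unfold sdiff. rewrite !IH by lia. reflexivity.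
Qed.

(** Complete monotonicity in terms of differences of step 1 instead of derivatives, a form that
    passes to pointwise limits. *)
Definition completely_monotone (f : R -> R) : Prop :=
  forall j x, 0 < x -> 0 <= (-1) ^ j * Nat.iter j rdiff f x.

Lemma cm_plus (f g : R -> R) : completely_monotone f -> completely_monotone g -> completely_monotone (fun x => f x + g x).
Proof.
intros Hf Hg j x Hx. rewrite iter_rdiff_plus, Rmult_plus_distr_l.
specialize (Hf j x Hx); specialize (Hg j x Hx); lra.
Qed.

Lemma cm_lim (F : nat -> R -> R) (f : R -> R) :
  (forall K, completely_monotone (F K)) -> (forall y, 0 < y -> is_lim_seq (fun K => F K y) (f y)) -> completely_monotone f.
Proof.
intros HF Hlim j x Hx.
apply (is_lim_seq_le (fun _ => 0) (fun K => (-1) ^ j * Nat.iter j rdiff (F K) x)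
  0 ((-1) ^ j * Nat.iter j rdiff f x)).
- intros K; now apply HF.
- apply is_lim_seq_const.
- apply (is_lim_seq_scal_l _ ((-1) ^ j) (Nat.iter j rdiff f x)).
  now apply iter_rdiff_lim.
Qed.

(** Exponentials are eigenfunctions of the difference operator, with eigenvalue [exp (- c) - 1],
    which is nonpositive for [c >= 0]. *)
Lemma iter_rdiff_exp (a c x : R) (j : nat) :
  Nat.iter j rdiff (fun y => a * exp (- c * y)) x = a * (exp (- c) - 1) ^ j * exp (- c * x).
Proof.
revert x; induction j as [|j IH]; intros x; simpl; [ring|].
unfold rdiff at 1. rewrite !IH.
replace (- c * (x + 1)) with (- c + - c * x) by ring. rewrite exp_plus. ring.
Qed.

Lemma cm_exp (a c : R) : 0 <= a -> 0 <= c -> completely_monotone (fun x => a * exp (- c * x)).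
Proof.
intros Ha Hc j x Hx. rewrite iter_rdiff_exp.
replace ((-1) ^ j * (a * (exp (- c) - 1) ^ j * exp (- c * x)))
  with (a * (1 - exp (- c)) ^ j * exp (- c * x)).
- apply Rmult_le_pos; [apply Rmult_le_pos; [exact Ha|apply pow_le]|left; apply exp_pos].
  destruct Hc as [Hc|<-]; [|rewrite Ropp_0, exp_0; lra].
  pose proof (exp_increasing (- c) 0 ltac:(lra)). rewrite exp_0 in H; lra.
- replace (1 - exp (- c)) with (-1 * (exp (- c) - 1)) by ring.
  rewrite Rpow_mult_distr; ring.
Qed.

Lemma cm_exp_sum (a : R) (K : nat) :
  0 <= a -> completely_monotone (fun x => sum_f_R0 (fun m => a * exp (- (a * INR (S m)) * x)) K).
Proof.
intros Ha; induction K as [|K IH].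
- apply cm_exp; [exact Ha|]. apply Rmult_le_pos; [exact Ha|apply pos_INR].
- apply (cm_plus _ (fun x => a * exp (- (a * INR (S (S K))) * x))); [exact IH|].
  apply cm_exp; [exact Ha|]. apply Rmult_le_pos; [exact Ha|apply pos_INR].
Qed.

Lemma exp_INR_mul (y : R) (m : nat) : exp (INR m * y) = exp y ^ m.
Proof.
induction m as [|m IH]; [simpl; rewrite Rmult_0_l; apply exp_0|].
rewrite S_INR, Rmult_plus_distr_r, exp_plus, IH, Rmult_1_l. simpl; ring.
Qed.

(** With q = exp(-a x) this is the sum of a q^(m+1) over m >= 0, a limit of sums of decaying
    exponentials. *)
Lemma cm_geometric (a : R) :
  0 < a -> completely_monotone (fun x => a * exp (- a * x) / (1 - exp (- a * x))).
Proof.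
intros Ha. apply cm_lim with
  (fun K x => sum_f_R0 (fun m => a * exp (- (a * INR (S m)) * x)) K).
{ intros K; apply cm_exp_sum; lra. }
intros y Hy. set (q := exp (- a * y)).
assert (Hq : 0 < q < 1).
{ split; [apply exp_pos|]. rewrite <- exp_0. apply exp_increasing. nra. }
assert (Hs : is_series (fun m => a * q * q ^ m) (a * q * / (1 - q))).
{ apply (is_series_scal_l (V := R_NormedModule) (a * q)), is_series_geom.
  rewrite Rabs_pos_eq; lra. }
eapply is_lim_seq_ext; [|exact Hs]. intros K; cbv beta.
rewrite sum_n_Reals. apply sum_eq. intros m _.
replace (- (a * INR (S m)) * y) with (INR (S m) * (- a * y)) by ring.
rewrite exp_INR_mul. fold q. simpl; ring.
Qed.

(** The rising factorial y (y+1) ... (y+j), with j + 1 factors. *)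
Fixpoint rising (j : nat) (y : R) : R :=
  match j with O => y | S i => rising i y * (y + INR (S i)) end.

Lemma rising_pos (j : nat) (y : R) : 0 < y -> 0 < rising j y.
Proof.
intros Hy; induction j as [|j IH]; [exact Hy|].
cbn [rising]. apply Rmult_lt_0_compat; [exact IH|]. pose proof (pos_INR (S j)); lra.
Qed.

Lemma rising_shift (j : nat) (y : R) :
  y * rising j (y + 1) = rising j y * (y + INR (S j)).
Proof.
induction j as [|j IH]; [simpl; ring|].
cbn [rising]. rewrite <- Rmult_assoc, IH, !S_INR. ring.
Qed.

(** Discrete counterpart of the derivative (-1)^j j! / x^(j+1) of 1/x, with the rising factorial in
    place of the power. *)
Lemma iter_rdiff_inv (c x : R) (j : nat) :
  0 < x + c ->
  Nat.iter j rdiff (fun y => / (y + c)) x = (-1) ^ j * INR (fact j) / rising j (x + c).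
Proof.
revert x; induction j as [|j IH]; intros x Hx; [simpl; field; lra|].
cbn [Nat.iter]. change (Nat.iter (S j) rdiff (fun y => / (y + c)) x)
  with (rdiff (Nat.iter j rdiff (fun y => / (y + c))) x).
unfold rdiff at 1. rewrite !IH by lra.
pose proof (rising_shift j (x + c)) as Hs.
replace (x + 1 + c) with (x + c + 1) by ring.
pose proof (rising_pos j (x + c) Hx). pose proof (rising_pos j (x + c + 1) ltac:(lra)).
pose proof (pos_INR (S j)).
assert (E : rising j (x + c + 1) = rising j (x + c) * (x + c + INR (S j)) / (x + c)).
{ rewrite <- Hs; field; lra. }
rewrite E. cbn [rising]. rewrite fact_simpl, mult_INR.
change ((-1) ^ S j) with (-1 * (-1) ^ j).
field. repeat split; lra.
Qed.

Lemma cm_inv (c : R) : 0 <= c -> completely_monotone (fun x => / (x + c)).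
Proof.
intros Hc j x Hx. rewrite iter_rdiff_inv by lra.
unfold Rdiv. rewrite <- !Rmult_assoc, <- Rpow_mult_distr.
replace (-1 * -1) with 1 by ring. rewrite pow1, Rmult_1_l.
apply Rmult_le_pos; [apply pos_INR|].
left; apply Rinv_0_lt_compat, rising_pos; lra.
Qed.

(** * Sequences whose differences alternate in sign *)

(** Orders start at 2 because log-convexity is a condition on second differences of the logarithm;
    affine summands are therefore neutral. *)
Definition alternating_differences (f : nat -> R) : Prop :=
  forall k n, (2 <= k)%nat -> (1 <= n)%nat -> 0 <= (-1) ^ k * Nat.iter k sdiff f n.

Lemma alternating_ext (f g : nat -> R) :
  (forall n, (1 <= n)%nat -> f n = g n) ->
  alternating_differences f -> alternating_differences g.
Proof.
intros E Hf k n Hk Hn. rewrite <- (iter_sdiff_ext f g) by assumption. now apply Hf.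
Qed.

Lemma alternating_plus (f g : nat -> R) :
  alternating_differences f -> alternating_differences g ->
  alternating_differences (fun n => f n + g n).
Proof.
intros Hf Hg k n Hk Hn.
assert (E : forall j m, Nat.iter j sdiff (fun i => f i + g i) m
  = Nat.iter j sdiff f m + Nat.iter j sdiff g m).
{ induction j as [|j IH]; intros m; simpl; [reflexivity|].
  unfold sdiff at 1. rewrite !IH. unfold sdiff; ring. }
rewrite E, Rmult_plus_distr_l.
specialize (Hf k n Hk Hn); specialize (Hg k n Hk Hn); lra.
Qed.

Lemma alternating_affine (a b : R) : alternating_differences (fun n => a + b * INR n).
Proof.
intros k n Hk Hn.
assert (E : forall j m, Nat.iter (S (S j)) sdiff (fun i => a + b * INR i) m = 0).
{ induction j as [|j IH]; intros m.
  - cbn -[INR]. unfold sdiff. rewrite !S_INR. ring.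
  - change (sdiff (Nat.iter (S (S j)) sdiff (fun i => a + b * INR i)) m = 0).
    unfold sdiff at 1. rewrite !IH. ring. }
destruct k as [|[|k]]; [lia|lia|]. rewrite E. lra.
Qed.

Lemma alternating_lim (F : nat -> nat -> R) (f : nat -> R) :
  (forall K, alternating_differences (F K)) ->
  (forall n, (1 <= n)%nat -> is_lim_seq (fun K => F K n) (f n)) ->
  alternating_differences f.
Proof.
intros HF Hlim k n Hk Hn.
apply (is_lim_seq_le (fun _ => 0) (fun K => (-1) ^ k * Nat.iter k sdiff (F K) n)
  0 ((-1) ^ k * Nat.iter k sdiff f n)).
- intros K; now apply HF.
- apply is_lim_seq_const.
- apply (is_lim_seq_scal_l _ ((-1) ^ k) (Nat.iter k sdiff f n)).
  clear Hk. revert n Hn; induction k as [|k IH]; intros n Hn; simpl; [now apply Hlim|].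
  apply is_lim_seq_minus'; apply IH; lia.
Qed.

(** The mean value theorem replaces one difference by a derivative, which is minus a completely
    monotone function; this minus sign makes up for the order lost. *)
Lemma alternating_ln_euler_factor (i : nat) :
  alternating_differences (fun n => - ln (euler_factor (S i) (2 * n))).
Proof.
unfold euler_factor. destruct (roughb _ _).
(* For a composite number the factor is 1 and its logarithm is 0. *)
2:{ apply alternating_ext with (fun n => 0 + 0 * INR n); [|apply alternating_affine].
    intros n _; rewrite ln_1; ring. }
set (p := INR (S (S i))).
assert (Hp : 1 < p) by (apply (lt_INR 1); lia).
(* Chosen so that p^(-2n) = exp(-a n). *)
set (a := 2 * ln p).
assert (Ha : 0 < a) by (pose proof (ln_increasing 1 p); rewrite ln_1 in H; unfold a; lra).
apply alternating_ext with (fun n => (fun x => - ln (1 - exp (- a * x))) (INR n)).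
{ intros n _. do 3 f_equal.
  replace (- a * INR n) with (- (INR (2 * n) * ln p))
    by (rewrite mult_INR; unfold a; simpl; ring).
  rewrite exp_Ropp, exp_INR_mul, exp_ln by lra. reflexivity. }
intros k n Hk Hn. rewrite (iter_sdiff_INR (fun x => - ln (1 - exp (- a * x)))).
destruct k as [|j]; [lia|].
destruct (iter_rdiff_MVT (fun x => - ln (1 - exp (- a * x)))
  (fun x => - (a * exp (- a * x) / (1 - exp (- a * x)))) j (INR n)) as [xi [Hxi E]].
- apply lt_0_INR; lia.
- intros y Hy.
  assert (Hq : 0 < exp (- a * y) < 1).
  { split; [apply exp_pos|]. rewrite <- exp_0. apply exp_increasing. nra. }
  auto_derive; [lra|]. field; lra.
- rewrite E.
  pose proof (cm_geometric a Ha j xi Hxi) as Hcm.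
  assert (En : forall m x, Nat.iter m rdiff (fun x => - (a * exp (- a * x) / (1 - exp (- a * x)))) x
    = - Nat.iter m rdiff (fun x => a * exp (- a * x) / (1 - exp (- a * x))) x).
  { induction m as [|m IH]; intros x; simpl; [reflexivity|].
    unfold rdiff at 1. rewrite !IH. unfold rdiff; ring. }
  rewrite En. simpl pow. lra.
Qed.

Lemma alternating_ln_zeta : alternating_differences (fun n => ln (zeta (2 * n))).
Proof.
apply alternating_lim with
  (fun K n => sum_f_R0 (fun i => - ln (euler_factor (S i) (2 * n))) K).
- induction K as [|K IH]; [apply alternating_ln_euler_factor|].
  apply (alternating_plus _ (fun n => - ln (euler_factor (S (S K)) (2 * n))));
    [exact IH|apply alternating_ln_euler_factor].
- intros n Hn. apply ln_zeta_euler; lia.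
Qed.

(** The first difference is ln(2n+1) + ln(2n+2), which extends smoothly to real arguments with
    derivative 1/(x+1/2) + 1/(x+1). So one difference removes the factorial and a second one becomes
    this derivative. *)
Lemma alternating_ln_fact : alternating_differences (fun n => ln (INR (fact (2 * n)))).
Proof.
intros k n Hk Hn. destruct k as [|[|j]]; [lia|lia|].
rewrite Nat.iter_succ_r.
rewrite (iter_sdiff_ext _ (fun m => (fun x => ln (2 * x + 1) + ln (2 * x + 2)) (INR m)))
  with (1 := Hn).
- rewrite (iter_sdiff_INR (fun x => ln (2 * x + 1) + ln (2 * x + 2))).
  destruct (iter_rdiff_MVT (fun x => ln (2 * x + 1) + ln (2 * x + 2))
    (fun x => / (x + / 2) + / (x + 1)) j (INR n)) as [xi [Hxi E]].
  + apply lt_0_INR; lia.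
  + intros y Hy. auto_derive; [lra|]. field; lra.
  + rewrite E.
    pose proof (cm_plus _ _ (cm_inv (/ 2) ltac:(lra)) (cm_inv 1 ltac:(lra)) j xi Hxi).
    simpl pow. lra.
- intros m _. unfold sdiff.
  replace (2 * S m)%nat with (S (S (2 * m))) by lia.
  assert (Hf : 0 < INR (fact (2 * m))) by apply lt_0_INR, lt_O_fact.
  assert (E1 : INR (S (2 * m)) = 2 * INR m + 1) by (rewrite S_INR, mult_INR; simpl; ring).
  assert (E2 : INR (S (S (2 * m))) = 2 * INR m + 2) by (rewrite S_INR, E1; ring).
  pose proof (pos_INR m).
  rewrite (fact_simpl (S (2 * m))), (fact_simpl (2 * m)), !mult_INR, E1, E2.
  rewrite !ln_mult; try lra. apply Rmult_lt_0_compat; lra.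
Qed.

(** * From alternating differences to log-monotonicity *)

Lemma iter_ratio_op_ln (x : nat -> R) (r n : nat) :
  positive_seq 1 x -> (1 <= n)%nat ->
  0 < Nat.iter r ratio_op x n /\
  ln (Nat.iter r ratio_op x n) = Nat.iter r sdiff (fun m => ln (x m)) n.
Proof.
intros Hx; revert n; induction r as [|r IH]; intros n Hn; simpl.
- split; [now apply Hx|reflexivity].
- unfold ratio_op at 1 3, sdiff at 1.
  destruct (IH n Hn) as [P1 E1]. destruct (IH (n + 1)%nat ltac:(lia)) as [P2 E2].
  split; [now apply Rdiv_lt_0_compat|].
  rewrite ln_div by assumption. now rewrite E2, E1, Nat.add_1_r.
Qed.

(** Since [ln] turns [ratio_op] into [sdiff], the condition on the [r]-th iterate at [n] is the sign
    of the difference of order r + 2 at n - 1, and (-1)^(r+2) = (-1)^r. *)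
Lemma log_monotonic_of_alternating (x : nat -> R) :
  positive_seq 1 x -> alternating_differences (fun n => ln (x n)) ->
  infinitely_log_monotonic 1 x.
Proof.
intros Hx Halt k _. split; [exact Hx|]. intros r _.
set (y := Nat.iter r ratio_op x).
assert (Hy : forall n, (1 <= n)%nat -> 0 < y n) by (intros n Hn; now apply iter_ratio_op_ln).
assert (Hd : forall n, (2 <= n)%nat ->
  0 <= (-1) ^ r * (ln (y (n - 1)%nat * y (n + 1)%nat) - ln (y n ^ 2))).
{ intros n Hn. specialize (Halt (S (S r)) (n - 1)%nat ltac:(lia) ltac:(lia)).
  simpl in Halt. unfold sdiff at 1 2 in Halt.
  replace (S (n - 1)) with n in Halt by lia.
  pose proof (proj2 (iter_ratio_op_ln x r (n - 1)%nat Hx ltac:(lia))) as E1.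
  pose proof (proj2 (iter_ratio_op_ln x r n Hx ltac:(lia))) as E2.
  pose proof (proj2 (iter_ratio_op_ln x r (S n) Hx ltac:(lia))) as E3.
  rewrite <- E1, <- E2, <- E3 in Halt. fold y in Halt.
  pose proof (Hy (n - 1)%nat ltac:(lia)). pose proof (Hy n ltac:(lia)).
  pose proof (Hy (S n) ltac:(lia)).
  rewrite Nat.add_1_r, ln_mult by assumption. rewrite ln_pow by assumption.
  simpl INR. lra. }
assert (Hle : forall u v, 0 < u -> 0 < v -> 0 <= ln v - ln u -> u <= v).
{ intros u v Hu Hv H. apply Rnot_lt_le; intros Hlt.
  pose proof (ln_increasing v u Hv Hlt); lra. }
assert (Hp : forall n, (2 <= n)%nat -> 0 < y n ^ 2 /\ 0 < y (n - 1)%nat * y (n + 1)%nat).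
{ intros n Hn. split; [apply pow_lt, Hy; lia|apply Rmult_lt_0_compat; apply Hy; lia]. }
split; intros [q Hq] n Hn; specialize (Hd n Hn); destruct (Hp n Hn) as [P1 P2].
- apply Hle; [assumption..|]. rewrite Hq, pow_1_even in Hd. lra.
- apply Rle_ge, Hle; [assumption..|].
  rewrite Hq, Nat.add_1_r, pow_1_odd in Hd. lra.
Qed.

(** * Partial fractions of the cotangent *)

(** Sum over k < n, possibly empty, whereas [sum_f_R0] always has at least one term. *)
Fixpoint psum (f : nat -> R) (n : nat) : R :=
  match n with O => 0 | S m => psum f m + f m end.

Lemma psum_ext (f g : nat -> R) (n : nat) :
  (forall k, (k < n)%nat -> f k = g k) -> psum f n = psum g n.
Proof.
intros H; induction n as [|n IH]; [reflexivity|].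
simpl; rewrite IH, H; auto with arith.
Qed.

Lemma psum_head (f : nat -> R) (n : nat) : psum f (S n) = f 0%nat + psum (fun k => f (S k)) n.
Proof.
induction n as [|n IH]; [simpl; ring|].
change (psum f (S (S n))) with (psum f (S n) + f (S n)). rewrite IH. simpl; ring.
Qed.

Lemma psum_lin (a b : R) (f g : nat -> R) (n : nat) :
  psum (fun k => a * f k + b * g k) n = a * psum f n + b * psum g n.
Proof. induction n as [|n IH]; simpl; [ring|rewrite IH; ring]. Qed.

Lemma psum_even_odd (f : nat -> R) (n : nat) :
  psum f (2 * n) = psum (fun k => f (2 * k)%nat) n + psum (fun k => f (2 * k + 1)%nat) n.
Proof.
induction n as [|n IH]; [simpl; ring|].
replace (2 * S n)%nat with (S (S (2 * n))) by lia. cbn [psum]. rewrite IH.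
replace (2 * n + 1)%nat with (S (2 * n)) by lia. ring.
Qed.

(** Folds a symmetric sum of 2m + 1 terms about its middle one; the induction strips one term off
    each end. *)
Lemma psum_fold (m : nat) : forall f : nat -> R,
  (forall k, (k <= 2 * m)%nat -> f k = f (2 * m - k)%nat) ->
  psum f (S (2 * m)) = f m + 2 * psum f m.
Proof.
induction m as [|m IH]; intros f Hf; [simpl; ring|].
replace (S (2 * S m)) with (S (S (S (2 * m)))) by lia.
change (psum f (S (S (S (2 * m))))) with (psum f (S (S (2 * m))) + f (S (S (2 * m)))).
rewrite psum_head, (IH (fun k => f (S k))).
- rewrite (psum_head f m), (Hf 0%nat) by lia.
  replace (2 * S m - 0)%nat with (S (S (2 * m))) by lia. ring.
- intros k Hk. rewrite (Hf (S k)) by lia. f_equal; lia.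
Qed.

(** Padding with zeros makes sums of growing length accessible to Tannery's theorem. *)
Lemma is_series_psum (f : nat -> R) (n : nat) :
  is_series (fun k => if (k <? n)%nat then f k else 0) (psum f n).
Proof.
set (g := fun k => if (k <? n)%nat then f k else 0).
change (is_lim_seq (sum_n g) (psum f n)).
apply is_lim_seq_ext_loc with (fun _ => psum f n); [|apply is_lim_seq_const].
assert (H1 : forall m, sum_f_R0 g m = psum g (S m)).
{ induction m as [|m IH]; [simpl; ring|]. rewrite tech5, IH. reflexivity. }
assert (H2 : forall i, psum g (n + i) = psum f n).
{ induction i as [|i IH].
  - rewrite Nat.add_0_r. apply psum_ext. intros k Hk. unfold g.
    now rewrite (proj2 (Nat.ltb_lt k n) Hk).
  - rewrite Nat.add_succ_r. cbn [psum]. rewrite IH. unfold g.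
    rewrite (proj2 (Nat.ltb_ge (n + i) n)) by lia. ring. }
exists n. intros m Hm. rewrite sum_n_Reals, H1.
replace (S m) with (n + (S m - n))%nat by lia. now rewrite H2.
Qed.

Definition cot (y : R) : R := cos y / sin y.

Lemma sin_half (x : R) : sin x = 2 * sin (x / 2) * cos (x / 2).
Proof. rewrite <- sin_2a. f_equal; field. Qed.

Lemma sin_half_shift (x : R) : sin ((x + PI) / 2) = cos (x / 2).
Proof.
replace ((x + PI) / 2) with (PI / 2 + x / 2) by field.
symmetry; apply cos_sin.
Qed.

(** As cot(y + PI/2) = -tan y, this is the duplication formula 2 cot 2y = cot y - tan y. *)
Lemma cot_half (x : R) : sin x <> 0 -> cot x = / 2 * (cot (x / 2) + cot ((x + PI) / 2)).
Proof.
intros Hx. rewrite sin_half in Hx.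
assert (Hs : sin (x / 2) <> 0) by (intros E; apply Hx; rewrite E; ring).
assert (Hc : cos (x / 2) <> 0) by (intros E; apply Hx; rewrite E; ring).
unfold cot. rewrite sin_half_shift.
replace (cos ((x + PI) / 2)) with (- sin (x / 2)).
- rewrite (sin_half x). replace (cos x) with (cos (2 * (x / 2))) by (f_equal; field).
  rewrite cos_2a. field; auto.
- replace ((x + PI) / 2) with (PI / 2 + x / 2) by field.
  rewrite sin_cos; ring.
Qed.

(** Repeated halving: the even-indexed terms come from x/2 and the odd-indexed ones from (x +
    PI)/2. *)
Lemma cot_sum (n : nat) : forall x, sin x <> 0 ->
  2 ^ n * cot x = psum (fun k => cot ((x + INR k * PI) / 2 ^ n)) (2 ^ n).
Proof.
induction n as [|n IH]; intros x Hx.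
- simpl. rewrite Rplus_0_l, Rmult_1_l. f_equal; field.
- pose proof Hx as Hx'. rewrite sin_half in Hx'.
  assert (Hs : sin (x / 2) <> 0) by (intros E; apply Hx'; rewrite E; ring).
  assert (Hc : sin ((x + PI) / 2) <> 0)
    by (rewrite sin_half_shift; intros E; apply Hx'; rewrite E; ring).
  assert (H2 : 2 ^ n <> 0) by (apply pow_nonzero; lra).
  replace (2 ^ S n * cot x) with (2 ^ n * cot (x / 2) + 2 ^ n * cot ((x + PI) / 2))
    by (rewrite (cot_half x Hx); simpl; field).
  rewrite (IH _ Hs), (IH _ Hc).
  change (2 ^ S n)%nat with (2 * 2 ^ n)%nat. rewrite psum_even_odd.
  f_equal; apply psum_ext; intros k _; f_equal.
  + rewrite mult_INR. simpl; field; auto.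
  + rewrite plus_INR, mult_INR. simpl; field; auto.
Qed.

(** Equals cot((k PI - x)/N) - cot((k PI + x)/N) away from the poles, written as a quotient of sines
    to ease bounds and limits. *)
Definition cot_gap (x N k : R) : R :=
  sin (2 * x / N) / (sin ((k * PI + x) / N) * sin ((k * PI - x) / N)).

Lemma cot_sub (a b : R) :
  sin a <> 0 -> sin b <> 0 -> cot b - cot a = sin (a - b) / (sin a * sin b).
Proof. intros Ha Hb; unfold cot. rewrite sin_minus. field; auto. Qed.

Lemma cot_gap_sym (x N k : R) : N <> 0 -> cot_gap x N (N - k) = cot_gap x N k.
Proof.
intros HN; unfold cot_gap. f_equal.
replace (((N - k) * PI + x) / N) with (PI - (k * PI - x) / N) by (field; auto).
replace (((N - k) * PI - x) / N) with (PI - (k * PI + x) / N) by (field; auto).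
rewrite !Rtrigo_facts.sin_pi_minus. ring.
Qed.

Lemma PI_gt_3 : 3 < PI.
Proof. pose proof PI2_3_2; lra. Qed.

(** Subtract [cot_sum] at -x from [cot_sum] at x and fold by the symmetry k -> N - k, where N =
    2^(n+1). The middle term k = N/2 = 2^n has no partner, hence its extra factor 1/2. *)
Lemma cot_partial (n : nat) (x : R) :
  0 < x <= 1 ->
  1 - x * cot x =
    (1 - x / 2 ^ S n * cot (x / 2 ^ S n)) + x / (2 * 2 ^ S n) * cot_gap x (2 ^ S n) (2 ^ n)
    + psum (fun k => x / 2 ^ S n * cot_gap x (2 ^ S n) (INR (S k))) (2 ^ n - 1).
Proof.
intros Hx. pose proof PI_gt_3 as HPI.
set (N := 2 ^ S n).
assert (HN : 2 <= N).
{ unfold N. simpl. pose proof (pow_R1_Rle 2 n ltac:(lra)). lra. }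
assert (Hsx : sin x <> 0) by (apply Rgt_not_eq, sin_gt_0; lra).
assert (HNn : INR (2 ^ S n) = N) by (rewrite pow_INR; reflexivity).
pose proof (cot_sum (S n) x Hsx) as E1.
pose proof (cot_sum (S n) (- x) ltac:(rewrite sin_neg; lra)) as E2.
fold N in E1, E2.
assert (Em : cot (- x) = - cot x).
{ unfold cot; rewrite cos_neg, sin_neg; field; auto. }
rewrite Em in E2.
set (m := (2 ^ n - 1)%nat).
assert (Hm : (2 ^ S n = S (S (2 * m)))%nat).
{ unfold m. pose proof (Nat.pow_nonzero 2 n ltac:(lia)). simpl; lia. }
set (f := fun k => cot_gap x N (INR (S k))).
(* The terms k = 0 give [2 * cot (x / N)], and those for 1 <= k <= N - 1 combine into minus the
   gaps. *)
assert (E : 2 * N * cot x = 2 * cot (x / N) - psum f (S (2 * m))).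
{ transitivity (1 * (N * cot x) + -1 * (N * - cot x)); [ring|].
  rewrite E1, E2, <- psum_lin, Hm, psum_head.
  replace (2 * cot (x / N) - psum f (S (2 * m)))
    with (2 * cot (x / N) + (-1 * psum f (S (2 * m)) + 0 * psum f (S (2 * m)))) by ring.
  rewrite <- psum_lin. f_equal.
  - change (INR 0) with 0. rewrite !Rmult_0_l, !Rplus_0_r.
    replace (- x / N) with (- (x / N)) by (field; lra).
    unfold cot. rewrite cos_neg, sin_neg.
    assert (sin (x / N) <> 0).
    { apply Rgt_not_eq, sin_gt_0; [apply Rdiv_lt_0_compat; lra|].
      apply Rmult_lt_reg_r with N; [lra|]. unfold Rdiv; rewrite Rmult_assoc, Rinv_l by lra. nra. }
    field; auto.
  - apply psum_ext. intros k Hk. unfold f, cot_gap.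
    assert (Hk1 : 1 <= INR (S k)) by (apply (le_INR 1); lia).
    assert (Hk2 : INR (S k) <= N - 1).
    { rewrite <- HNn, Hm, (S_INR (S (2 * m))). apply Rle_trans with (INR (S (2 * m))); [|lra].
      apply le_INR; lia. }
    assert (Hs : forall z, 0 < z < N * PI -> sin (z / N) <> 0).
    { intros z Hz. apply Rgt_not_eq, sin_gt_0; [apply Rdiv_lt_0_compat; lra|].
      apply Rmult_lt_reg_r with N; [lra|]. unfold Rdiv; rewrite Rmult_assoc, Rinv_l by lra. lra. }
    pose proof (Hs (INR (S k) * PI + x) ltac:(nra)) as H1.
    pose proof (Hs (INR (S k) * PI - x) ltac:(nra)) as H2.
    replace (2 * x / N) with ((INR (S k) * PI + x) / N - (INR (S k) * PI - x) / N)
      by (field; lra).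
    rewrite <- cot_sub by assumption.
    replace (x + INR (S k) * PI) with (INR (S k) * PI + x) by ring.
    replace (- x + INR (S k) * PI) with (INR (S k) * PI - x) by ring. ring. }
rewrite psum_fold in E.
- replace (cot x) with ((2 * cot (x / N) - (f m + 2 * psum f m)) / (2 * N))
    by (rewrite <- E; field; lra).
  replace (psum (fun k => x / N * cot_gap x N (INR (S k))) m)
    with (x / N * psum f m + 0 * psum f m).
  + unfold f at 1. replace (INR (S m)) with (2 ^ n); [field; lra|].
    unfold m. replace (S (2 ^ n - 1)) with (2 ^ n)%nat.
    * rewrite pow_INR; reflexivity.
    * pose proof (Nat.pow_nonzero 2 n ltac:(lia)); lia.
  + rewrite <- psum_lin. apply psum_ext. intros k _. unfold f; ring.
- intros k Hk. unfold f. rewrite <- (cot_gap_sym x N (INR (S k))) by lra.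
  f_equal. rewrite <- HNn, Hm. rewrite <- minus_INR by lia. f_equal; lia.
Qed.

Lemma inv_pow2_lim (c : R) : is_lim_seq (fun n => c / 2 ^ S n) 0.
Proof.
apply is_lim_seq_ext with (fun n => c * (/ 2) ^ S n).
{ intros n; rewrite pow_inv; reflexivity. }
replace (Finite 0) with (Rbar_mult c 0) by (simpl; f_equal; ring).
apply is_lim_seq_scal_l. apply -> (is_lim_seq_incr_1 (fun n => (/ 2) ^ n)).
apply is_lim_seq_geom. rewrite Rabs_pos_eq; lra.
Qed.

Lemma sin_pow2_lim (c : R) : c <> 0 -> is_lim_seq (fun n => 2 ^ S n * sin (c / 2 ^ S n)) c.
Proof.
intros Hc.
assert (H2 : forall n, 2 ^ n <> 0) by (intros n; apply pow_nonzero; lra).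
apply is_lim_seq_ext with (fun n => c * (sin (c / 2 ^ S n) / (c / 2 ^ S n))).
{ intros n; pose proof (H2 (S n)). field; auto. }
replace (Finite c) with (Rbar_mult c 1) by (simpl; f_equal; ring).
apply is_lim_seq_scal_l.
apply (is_lim_comp_seq (fun y => sin y / y) _ 0 1 is_lim_sinc_0); [|apply inv_pow2_lim].
exists 0%nat. intros n _ E. injection E as E.
apply (Rmult_integral_contrapositive_currified c (/ 2 ^ S n) Hc); [|exact E].
apply Rinv_neq_0_compat, H2.
Qed.

Lemma cos_pow2_lim (c : R) : is_lim_seq (fun n => cos (c / 2 ^ S n)) 1.
Proof.
rewrite <- cos_0. apply is_lim_seq_continuous; [apply continuity_cos|apply inv_pow2_lim].
Qed.

(** From sin y >= y (1 - y^2/6) and y <= PI/2 <= 2. *)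
Lemma sin_ge_third (y : R) : 0 <= y <= PI / 2 -> y / 3 <= sin y.
Proof.
intros Hy. pose proof PI_4. pose proof PI_gt_3.
destruct (sin_bound y 0) as [Hl _]; [lra|lra|].
eapply Rle_trans; [|exact Hl].
replace (sin_approx y (2 * 0 + 1)) with (y * (1 - y ^ 2 / 6))
  by (unfold sin_approx, sin_term; simpl; field).
assert (y ^ 2 <= 4) by nra. nra.
Qed.

(** Supplies the dominating series. Since k + 1 <= N/2, both denominator angles lie in [0, PI/2],
    where sin y >= y/3; with sin y <= y in the numerator [N] cancels, leaving 18 x^2 / (k^2 PI^2 -
    x^2). *)
Lemma cot_gap_bound (x N k : R) :
  0 < x <= 1 -> 0 < N -> 1 <= k -> k + 1 <= N / 2 ->
  0 <= x / N * cot_gap x N k <= 3 * / k ^ 2.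
Proof.
intros Hx HN Hk HkN. pose proof PI_gt_3. unfold cot_gap.
set (i := / N). assert (Hi : 0 < i) by (apply Rinv_0_lt_compat; lra).
assert (HiN : N * i = 1) by (apply Rinv_r; lra).
unfold Rdiv; fold i.
set (u := (k * PI + x) * i). set (v := (k * PI - x) * i).
assert (Hv : 0 < v) by (apply Rmult_lt_0_compat; nra).
assert (Hu : 0 < u <= PI / 2).
{ split; [apply Rmult_lt_0_compat; nra|].
  replace (PI / 2) with (N / 2 * PI * i) by (unfold Rdiv; nra).
  apply Rmult_le_compat_r; nra. }
assert (Hv2 : v <= PI / 2).
{ apply Rle_trans with u; [apply Rmult_le_compat_r; lra|lra]. }
pose proof (sin_ge_third u ltac:(lra)) as Su. pose proof (sin_ge_third v ltac:(lra)) as Sv.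
assert (Hs0 : 0 <= sin (2 * x * i) <= 2 * x * i).
{ assert (0 < 2 * x * i) by (apply Rmult_lt_0_compat; lra).
  split; [|left; now apply sin_lt_x]. apply sin_ge_0; [lra|].
  apply Rle_trans with (2 * (u * 1)); [|lra]. unfold u.
  rewrite Rmult_1_r. rewrite <- Rmult_assoc. apply Rmult_le_compat_r; nra. }
assert (Hden : u * v / 9 <= sin u * sin v) by nra.
assert (Huv : 0 < u * v) by (apply Rmult_lt_0_compat; lra).
split.
- apply Rmult_le_pos; [apply Rmult_le_pos; lra|]. apply Rmult_le_pos; [lra|].
  left; apply Rinv_0_lt_compat; lra.
- apply Rle_trans with (x * i * (2 * x * i * / (u * v / 9))).
  + apply Rmult_le_compat_l; [apply Rmult_le_pos; lra|].
    apply Rmult_le_compat; [lra| |lra|].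
    * left; apply Rinv_0_lt_compat; lra.
    * apply Rinv_le_contravar; lra.
  + assert (Hk2 : 0 < k ^ 2) by (apply pow_lt; lra).
    assert (Hp : 0 < k ^ 2 * PI ^ 2 - x ^ 2).
    { replace (k ^ 2 * PI ^ 2 - x ^ 2) with ((k * PI + x) * (k * PI - x)) by ring.
      apply Rmult_lt_0_compat; nra. }
    replace (x * i * (2 * x * i * / (u * v / 9)))
      with (18 * x ^ 2 * / (k ^ 2 * PI ^ 2 - x ^ 2)).
    * apply Rmult_le_reg_r with (k ^ 2 * (k ^ 2 * PI ^ 2 - x ^ 2));
        [apply Rmult_lt_0_compat; lra|].
      replace (18 * x ^ 2 * / (k ^ 2 * PI ^ 2 - x ^ 2) * (k ^ 2 * (k ^ 2 * PI ^ 2 - x ^ 2)))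
        with (18 * x ^ 2 * k ^ 2) by (field; lra).
      replace (3 * / k ^ 2 * (k ^ 2 * (k ^ 2 * PI ^ 2 - x ^ 2)))
        with (3 * (k ^ 2 * PI ^ 2 - x ^ 2)) by (field; lra).
      assert (9 <= PI ^ 2) by nra. assert (x ^ 2 <= 1) by nra. assert (1 <= k ^ 2) by nra.
      nra.
    * unfold u, v. field. repeat split; nra.
Qed.

Lemma cot_gap_lim (x k : R) :
  0 < x <= 1 -> 1 <= k ->
  is_lim_seq (fun n => x / 2 ^ S n * cot_gap x (2 ^ S n) k)
    (2 * x ^ 2 / ((k * PI) ^ 2 - x ^ 2)).
Proof.
intros Hx Hk. pose proof PI_gt_3.
assert (H1 : 0 < k * PI + x) by nra. assert (H2 : 0 < k * PI - x) by nra.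
apply is_lim_seq_ext with (fun n => x * ((2 ^ S n * sin (2 * x / 2 ^ S n)) /
  ((2 ^ S n * sin ((k * PI + x) / 2 ^ S n)) * (2 ^ S n * sin ((k * PI - x) / 2 ^ S n))))).
{ intros n; unfold cot_gap. assert (HN : 2 ^ S n <> 0) by (apply pow_nonzero; lra).
  unfold Rdiv. rewrite !Rinv_mult.
  generalize (/ sin ((k * PI + x) * / 2 ^ S n)) (/ sin ((k * PI - x) * / 2 ^ S n)).
  intros. field; exact HN. }
replace (2 * x ^ 2 / ((k * PI) ^ 2 - x ^ 2))
  with (x * ((2 * x) / ((k * PI + x) * (k * PI - x)))) by (field; split; nra).
apply (is_lim_seq_scal_l _ x (2 * x / ((k * PI + x) * (k * PI - x)))).
apply is_lim_seq_div'; [apply sin_pow2_lim; lra| |].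
- apply is_lim_seq_mult'; apply sin_pow2_lim; lra.
- apply Rgt_not_eq, Rmult_lt_0_compat; lra.
Qed.

(** Tannery's theorem for the sum in [cot_partial]; the two terms outside the sum vanish in the
    limit. *)
Lemma cot_partial_fractions (x : R) :
  0 < x <= 1 ->
  is_series (fun k => 2 * x ^ 2 / ((INR (S k) * PI) ^ 2 - x ^ 2)) (1 - x * cot x).
Proof.
intros Hx.
set (a := fun n k => if (k <? 2 ^ n - 1)%nat
  then x / 2 ^ S n * cot_gap x (2 ^ S n) (INR (S k)) else 0).
set (b := fun k => 2 * x ^ 2 / ((INR (S k) * PI) ^ 2 - x ^ 2)).
assert (H1 : forall k, 1 <= INR (S k)) by (intros k; apply (le_INR 1); lia).
destruct (tannery a b (fun k => 3 * / INR (S k) ^ 2)) as [Hex Hlim].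
- exact (ex_series_scal_l 3 _ ex_series_inv_sqr).
- intros n k; unfold a. destruct (Nat.ltb_spec k (2 ^ n - 1)) as [Hk|Hk].
  + assert (HN : 0 < 2 ^ S n) by (apply pow_lt; lra).
    assert (HkN : INR (S k) + 1 <= 2 ^ S n / 2).
    { rewrite <- S_INR. replace (2 ^ S n / 2) with (INR (2 ^ n)).
      - apply le_INR; lia.
      - rewrite pow_INR. change (INR 2) with 2. simpl; field. }
    pose proof (cot_gap_bound x (2 ^ S n) (INR (S k)) Hx HN (H1 k) HkN).
    rewrite Rabs_pos_eq; lra.
  + rewrite Rabs_R0. left; apply Rmult_lt_0_compat; [lra|].
    apply Rinv_0_lt_compat, pow_lt. specialize (H1 k); lra.
- intros k. eapply is_lim_seq_ext_loc; [|exact (cot_gap_lim x (INR (S k)) Hx (H1 k))].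
  exists (S (S k)). intros n Hn. unfold a.
  pose proof (Nat.pow_gt_lin_r 2 n ltac:(lia)).
  now rewrite (proj2 (Nat.ltb_lt k (2 ^ n - 1)%nat)) by lia.
- replace (1 - x * cot x) with (Series b); [exact (Series_correct _ Hex)|].
  assert (L1 : is_lim_seq (fun n => 1 - x / 2 ^ S n * cot (x / 2 ^ S n)) 0).
  { apply is_lim_seq_ext with
      (fun n => 1 - x * (cos (x / 2 ^ S n) / (2 ^ S n * sin (x / 2 ^ S n)))).
    - intros n. unfold cot, Rdiv. rewrite Rinv_mult. ring.
    - replace (Finite 0) with (Finite (1 - x * (1 / x))) by (f_equal; field; lra).
      apply is_lim_seq_minus'; [apply is_lim_seq_const|].
      apply (is_lim_seq_scal_l _ x (1 / x)).
      apply is_lim_seq_div'; [apply cos_pow2_lim|apply sin_pow2_lim; lra|lra]. }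
  (* At k = N/2 both sines in the denominator equal cos(x/N), which tends to 1. *)
  assert (L2 : is_lim_seq (fun n => x / (2 * 2 ^ S n) * cot_gap x (2 ^ S n) (2 ^ n)) 0).
  { apply is_lim_seq_ext with (fun n => x / 2 / 2 ^ S n *
      (sin (2 * x / 2 ^ S n) / (cos (x / 2 ^ S n) * cos (x / 2 ^ S n)))).
    - intros n. unfold cot_gap. assert (HN : 2 ^ n <> 0) by (apply pow_nonzero; lra).
      replace ((2 ^ n * PI + x) / 2 ^ S n) with (PI / 2 + x / 2 ^ S n) by (simpl; field; auto).
      replace ((2 ^ n * PI - x) / 2 ^ S n) with (PI / 2 - x / 2 ^ S n) by (simpl; field; auto).
      rewrite sin_shift, <- cos_sin. f_equal. unfold Rdiv; rewrite Rinv_mult; ring.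
    - replace (Finite 0) with (Finite (0 * (0 / (1 * 1)))) by (f_equal; field).
      apply is_lim_seq_mult'; [apply inv_pow2_lim|].
      apply is_lim_seq_div'; [| |lra].
      + rewrite <- sin_0.
        apply is_lim_seq_continuous; [apply continuity_sin|apply inv_pow2_lim].
      + apply is_lim_seq_mult'; apply cos_pow2_lim. }
  pose proof (is_lim_seq_plus' _ _ _ _ (is_lim_seq_plus' _ _ _ _ L1 L2) Hlim) as L.
  assert (L' : is_lim_seq (fun _ : nat => 1 - x * cot x) (0 + 0 + Series b)).
  { eapply is_lim_seq_ext; [|exact L]. intros n; cbv beta.
    rewrite (cot_partial n x Hx). f_equal.
    exact (is_series_unique _ _ (is_series_psum _ _)). }
  apply is_lim_seq_unique in L'. rewrite Lim_seq_const in L'.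
  injection L' as L'. lra.
Qed.

(** * Euler's formula for the even Bernoulli numbers *)

(* Coefficients of [x cot x] as a power series in [x^2]. *)
Definition cot_coef (j : nat) : R :=
  match j with O => 1 | S _ => - (2 * zeta (2 * j) / PI ^ (2 * j)) end.

(** Each partial fraction is 2q/(1-q) with q = x^2/(k PI)^2. Expand it geometrically and exchange
    sums: summing q^(j+1) over k produces zeta(2j+2). *)
Lemma cot_pseries (x : R) : 0 < x <= 1 -> is_pseries cot_coef (x ^ 2) (x * cot x).
Proof.
intros Hx. pose proof PI_gt_3 as HPI.
set (q := fun k => x ^ 2 / (INR (S k) * PI) ^ 2).
assert (H1 : forall k, 1 <= INR (S k)) by (intros k; apply (le_INR 1); lia).
assert (Hkp : forall k, 3 < INR (S k) * PI) by (intros k; specialize (H1 k); nra).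
assert (Hq : forall k, 0 < q k < 1).
{ intros k; specialize (Hkp k); unfold q. split.
  - apply Rdiv_lt_0_compat; apply pow_lt; lra.
  - apply Rmult_lt_reg_r with ((INR (S k) * PI) ^ 2); [apply pow_lt; lra|].
    unfold Rdiv. rewrite Rmult_assoc, Rinv_l by (apply pow_nonzero; lra). nra. }
pose proof (cot_partial_fractions x Hx) as Hpf.
assert (Hsw : is_series (fun j => Series (fun k => 2 * q k * q k ^ j)) (1 - x * cot x)).
{ rewrite <- (is_series_unique _ _ Hpf).
  apply (series_swap (fun j k => 2 * q k * q k ^ j)).
  - intros j k; specialize (Hq k). apply Rmult_le_pos; [lra|apply pow_le; lra].
  - intros k; specialize (Hq k); specialize (Hkp k).
    replace (2 * x ^ 2 / ((INR (S k) * PI) ^ 2 - x ^ 2)) with (2 * q k * / (1 - q k)).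
    + apply (is_series_scal_l (V := R_NormedModule) (2 * q k)), is_series_geom.
      rewrite Rabs_pos_eq; lra.
    + unfold q. field. split; [nra|]. split; [lra|]. specialize (H1 k); lra.
  - eexists; exact Hpf. }
apply is_pseries_R.
apply (is_series_decr_1 (V := R_NormedModule)).
match goal with |- is_series _ ?l => replace l with (-1 * (1 - x * cot x)) end.
2:{ unfold plus, opp; simpl; ring. }
eapply is_series_ext; [|exact (is_series_scal_l (V := R_NormedModule) (-1) _ _ Hsw)].
intros j. unfold scal; simpl scal. unfold mult; cbn -[Series q cot_coef pow Nat.mul].
assert (E : Series (fun k => 2 * q k * q k ^ j)
  = 2 * (x ^ 2) ^ S j / PI ^ (2 * S j) * zeta (2 * S j)).
{ unfold zeta. rewrite <- Series_scal_l. apply Series_ext. intros k.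
  specialize (H1 k). unfold q. rewrite Rmult_assoc.
  change (x ^ 2 / (INR (S k) * PI) ^ 2 * (x ^ 2 / (INR (S k) * PI) ^ 2) ^ j)
    with ((x ^ 2 / (INR (S k) * PI) ^ 2) ^ S j).
  unfold Rdiv. rewrite !Rpow_mult_distr, pow_inv, !Rpow_mult_distr, <- !pow_mult.
  field. split; apply pow_nonzero; lra. }
rewrite E. unfold cot_coef. field. apply pow_nonzero; lra.
Qed.

Lemma zeta_le_2 (s : nat) : (2 <= s)%nat -> zeta s <= 2.
Proof.
intros Hs. apply Rle_trans with (zeta 2).
- apply Series_le; [|exact ex_series_inv_sqr].
  intros k; pose proof (inv_pow_bound s k Hs); lra.
- apply (is_lim_seq_le (sum_n (fun k => / INR (S k) ^ 2)) (fun _ => 2) (zeta 2) 2).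
  + intros n; rewrite sum_n_Reals. pose proof (sum_inv_sqr_le n).
    assert (0 < / INR (S n)) by (apply Rinv_0_lt_compat, lt_0_INR; lia). lra.
  + exact (Series_correct _ ex_series_inv_sqr).
  + apply is_lim_seq_const.
Qed.

(** Through [CV_radius_ge1] this yields absolute convergence on |y| < 1, as Cauchy products
    require. *)
Lemma cot_coef_bound (j : nat) : Rabs (cot_coef j) <= 1.
Proof.
destruct j as [|j]; [unfold cot_coef; rewrite Rabs_R1; lra|].
unfold cot_coef. rewrite Rabs_Ropp. pose proof PI_gt_3.
pose proof (zeta_le_2 (2 * S j) ltac:(lia)). pose proof (zeta_ge_1 (2 * S j) ltac:(lia)).
assert (H9 : 4 <= PI ^ (2 * S j)).
{ rewrite pow_mult. apply Rle_trans with ((PI ^ 2) ^ 1); [nra|].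
  apply Rle_pow; [nra|lia]. }
rewrite Rabs_pos_eq.
- apply Rmult_le_reg_r with (PI ^ (2 * S j)); [lra|].
  unfold Rdiv; rewrite Rmult_assoc, Rinv_l by lra. lra.
- apply Rmult_le_pos; [lra|left; apply Rinv_0_lt_compat; lra].
Qed.

Lemma inv_fact_bound (n : nat) : Rabs (/ INR (fact n)) <= 1.
Proof.
assert (H : 1 <= INR (fact n)) by (apply (le_INR 1), lt_O_fact).
rewrite Rabs_pos_eq by (left; apply Rinv_0_lt_compat; lra).
rewrite <- Rinv_1. apply Rinv_le_contravar; lra.
Qed.

Lemma sign_mul_bound (n : nat) (r : R) : Rabs r <= 1 -> Rabs ((-1) ^ n * r) <= 1.
Proof. intros Hr. now rewrite Rabs_mult, pow_1_abs, Rmult_1_l. Qed.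

Lemma cos_pseries (x : R) : is_pseries cos_n (x ^ 2) (cos x).
Proof.
apply is_pseries_R, is_series_Reals. unfold cos.
destruct (exist_cos (Rsqr x)) as [l Hl].
rewrite <- Rsqr_pow2. exact Hl.
Qed.

Lemma sin_pseries (x : R) : x <> 0 -> is_pseries sin_n (x ^ 2) (sin x / x).
Proof.
intros Hx. apply is_pseries_R, is_series_Reals. unfold sin.
destruct (exist_sin (Rsqr x)) as [l Hl].
replace (x * l / x) with l by (field; exact Hx).
rewrite <- Rsqr_pow2. exact Hl.
Qed.

(** Uniqueness from positive arguments only, because y = x^2 will be substituted. Continuity along
    1/2^(m+1) kills the constant coefficient; then divide by y and induct. *)
Lemma pseries_0_coef (n : nat) : forall d : nat -> R,
  (forall y, 0 < y < 1 -> is_pseries d y 0) -> d n = 0.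
Proof.
assert (H0 : forall d : nat -> R, (forall y, 0 < y < 1 -> is_pseries d y 0) -> d 0%nat = 0).
{ intros d Hd.
  assert (HR : Rbar_lt (Finite 0) (CV_radius d)).
  { assert (Hh : Rabs (/ 2) = / 2) by (apply Rabs_pos_eq; lra).
    apply Rbar_lt_le_trans with (Finite (Rabs (/ 2))); [rewrite Hh; simpl; lra|].
    apply Rbar_not_lt_le; intros Hlt. apply (CV_disk_outside _ _ Hlt).
    apply ex_series_lim_0. eexists. apply is_pseries_R, Hd; lra. }
  assert (Hc : continuity_pt (PSeries d) 0)
    by (apply PSeries_continuity; now rewrite Rabs_R0).
  pose proof (is_lim_seq_continuous _ _ _ Hc (inv_pow2_lim 1)) as Hl.
  rewrite PSeries_0 in Hl.
  assert (Hl' : is_lim_seq (fun _ : nat => 0) (d 0%nat)).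
  { eapply is_lim_seq_ext; [|exact Hl]. intros m; cbv beta.
    apply is_pseries_unique, Hd. pose proof (pow_R1_Rle 2 m ltac:(lra)).
    assert (H2 : 2 <= 2 ^ S m) by (simpl; lra).
    split; [apply Rdiv_lt_0_compat; lra|].
    apply Rmult_lt_reg_r with (2 ^ S m); [lra|].
    unfold Rdiv; rewrite Rmult_assoc, Rinv_l by lra. lra. }
  apply is_lim_seq_unique in Hl'. rewrite Lim_seq_const in Hl'. now injection Hl'. }
induction n as [|n IH]; intros d Hd; [now apply H0|].
change (d (S n)) with (PS_decr_1 d n). apply IH. intros y Hy.
pose proof (is_pseries_decr_1 d y (/ y) 0 ltac:(apply (Rinv_l y); lra) (Hd y Hy)) as H.
rewrite (H0 d Hd) in H.
match type of H with is_pseries _ _ ?l => replace l with 0 in H end; [exact H|].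
unfold scal, plus, opp; simpl; unfold mult; simpl; ring.
Qed.

(** Compares coefficients in (x cot x) (sin x / x) = cos x, as power series in y = x^2. *)
Lemma cot_coef_recursion (n : nat) : PS_mult cot_coef sin_n n = cos_n n.
Proof.
apply Rminus_diag_uniq.
change (PS_mult cot_coef sin_n n - cos_n n)
  with (PS_minus (PS_mult cot_coef sin_n) cos_n n).
apply pseries_0_coef. intros y Hy.
set (x := sqrt y). assert (Hx : 0 < x) by (apply sqrt_lt_R0; lra).
assert (Hxy : x ^ 2 = y) by (unfold x; rewrite <- Rsqr_pow2; apply Rsqr_sqrt; lra).
assert (Hx1 : x <= 1) by nra.
assert (Hr : forall a, (forall m, Rabs (a m) <= 1) -> Rbar_lt (Finite (Rabs y)) (CV_radius a)).
{ intros a Ha; apply CV_radius_ge1; [exact Ha|]. rewrite Rabs_pos_eq; lra. }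
pose proof (cot_pseries x (conj Hx Hx1)) as HA.
pose proof (sin_pseries x ltac:(lra)) as HS. pose proof (cos_pseries x) as HC.
rewrite Hxy in HA, HS, HC.
assert (HM : is_pseries (PS_mult cot_coef sin_n) y (x * cot x * (sin x / x))).
{ apply is_pseries_mult; [exact HA|exact HS|apply Hr, cot_coef_bound|].
  apply Hr. intros m. apply sign_mul_bound, inv_fact_bound. }
match goal with |- is_pseries _ _ ?l =>
  replace l with (plus (x * cot x * (sin x / x)) (opp (cos x))) end.
- now apply (is_pseries_minus (V := R_NormedModule)).
- unfold plus, opp; simpl. unfold cot. field. split; [lra|].
  pose proof PI_gt_3. apply Rgt_not_eq, sin_gt_0; lra.
Qed.

(* [coth_coef], the coefficients of [u coth u] in powers of [u^2], arise from
   those of [x cot x] by substituting [x = i u]. *)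
Definition coth_coef (j : nat) : R := (-1) ^ j * cot_coef j.

(** Distributing (-1)^n = (-1)^i (-1)^(n-i) over the Cauchy product turns the coefficients of cos
    and sin into those of cosh and sinh, so x = i u is handled over the reals. *)
Lemma coth_coef_recursion (n : nat) :
  PS_mult coth_coef (fun j => / INR (fact (2 * j + 1))) n = / INR (fact (2 * n)).
Proof.
replace (/ INR (fact (2 * n))) with ((-1) ^ n * cos_n n).
- rewrite <- cot_coef_recursion. unfold PS_mult. rewrite scal_sum.
  apply sum_eq. intros i Hi. unfold coth_coef, sin_n.
  assert (En : (-1) ^ n = (-1) ^ i * (-1) ^ (n - i)) by (rewrite <- pow_add; f_equal; lia).
  rewrite En.
  assert (E : (-1) ^ (n - i) * (-1) ^ (n - i) = 1).
  { rewrite <- Rpow_mult_distr. replace (-1 * -1) with 1 by ring. apply pow1. }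
  transitivity ((-1) ^ i * cot_coef i * / INR (fact (2 * (n - i) + 1))
    * ((-1) ^ (n - i) * (-1) ^ (n - i))); [rewrite E; ring|].
  unfold Rdiv; ring.
- unfold cos_n, Rdiv. rewrite <- Rmult_assoc, <- Rpow_mult_distr.
  replace (-1 * -1) with 1 by ring. rewrite pow1; ring.
Qed.

(** Here E = cosh u and O = sinh u / u. The recursion says A O = E, and exp(2u) - 1 = 2 u O (E + u
    O), so (A - u) (exp(2u) - 1) = 2u (E - u O) (E + u O) = 2u. *)
Lemma coth_pseries (u : R) :
  0 < Rabs u < 1 -> is_pseries coth_coef (u ^ 2) (2 * u / (exp (2 * u) - 1) + u).
Proof.
intros Hu.
assert (Hu0 : u <> 0) by (intros ->; rewrite Rabs_R0 in Hu; lra).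
assert (Hu2 : Rabs (u ^ 2) < 1).
{ rewrite <- RPow_abs. pose proof (Rabs_pos u). nra. }
assert (Hr : forall a, (forall m, Rabs (a m) <= 1) ->
  Rbar_lt (Finite (Rabs (u ^ 2))) (CV_radius a)).
{ intros a Ha; now apply CV_radius_ge1. }
assert (RA : Rbar_lt (Finite (Rabs (u ^ 2))) (CV_radius coth_coef)).
{ apply Hr. intros m; apply sign_mul_bound, cot_coef_bound. }
set (o := fun j => / INR (fact (2 * j + 1))). set (e := fun j => / INR (fact (2 * j))).
assert (Ro : Rbar_lt (Finite (Rabs (u ^ 2))) (CV_radius o))
  by (apply Hr; intros m; apply inv_fact_bound).
assert (Re : Rbar_lt (Finite (Rabs (u ^ 2))) (CV_radius e))
  by (apply Hr; intros m; apply inv_fact_bound).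
set (A := PSeries coth_coef (u ^ 2)). set (O := PSeries o (u ^ 2)).
set (E := PSeries e (u ^ 2)).
assert (HAO : A * O = E).
{ unfold A, O, E. rewrite <- PSeries_mult by assumption.
  apply PSeries_ext, coth_coef_recursion. }
(* Even and odd parts of the exponential series, to be used at both u and -u. *)
assert (Hexp : forall v, v ^ 2 = u ^ 2 -> exp v = E + v * O).
{ intros v Hv. rewrite <- (is_pseries_unique _ _ _ (is_exp_Reals v)).
  apply is_pseries_unique.
  apply (is_pseries_odd_even (fun n => / INR (fact n)));
    rewrite Hv; apply PSeries_correct, CV_radius_inside; assumption. }
pose proof (Hexp u eq_refl) as H1.
pose proof (Hexp (- u) ltac:(ring)) as H2.
assert (H12 : (E + u * O) * (E - u * O) = 1).
{ replace (E - u * O) with (E + - u * O) by ring. rewrite <- H1, <- H2, <- exp_plus.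
  rewrite Rplus_opp_r. apply exp_0. }
assert (H3 : exp (2 * u) = (E + u * O) * (E + u * O)).
{ rewrite <- H1, <- exp_plus. f_equal; ring. }
assert (Hne : exp (2 * u) - 1 <> 0).
{ intros H. assert (2 * u = 0) by (apply exp_inv; rewrite exp_0; lra). lra. }
replace (2 * u / (exp (2 * u) - 1) + u) with A.
- apply PSeries_correct, CV_radius_inside, RA.
- cut (2 * u = (A - u) * (exp (2 * u) - 1)).
  { intros Hcut. replace (2 * u / (exp (2 * u) - 1)) with (A - u); [ring|].
    apply Rmult_eq_reg_r with (exp (2 * u) - 1); [|exact Hne].
    unfold Rdiv. rewrite Rmult_assoc, Rinv_l by exact Hne. lra. }
  rewrite H3.
  replace ((E + u * O) * (E + u * O) - 1)
    with ((E + u * O) * (E + u * O) - (E + u * O) * (E - u * O)) by (rewrite H12; reflexivity).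
  transitivity (2 * u * ((E + u * O) * (E - u * O))); [rewrite H12; ring|].
  rewrite <- HAO. ring.
Qed.

(** * The generating function of the Bernoulli numbers *)

(** These are B_n / n!: the powers of 4 come from u = t/2, and -t/2 is the whole odd part of t/(e^t
    - 1). *)
Definition bernoulli_egf_coef (n : nat) : R :=
  if Nat.even n then coth_coef (n / 2) / 4 ^ (n / 2)
  else if (n =? 1)%nat then - / 2 else 0.

Lemma bernoulli_egf (t : R) :
  0 < Rabs t < 1 -> is_pseries bernoulli_egf_coef t (t / (exp t - 1)).
Proof.
intros Ht.
assert (Hu : 0 < Rabs (t / 2) < 1).
{ unfold Rdiv. rewrite Rabs_mult, (Rabs_pos_eq (/ 2)); lra. }
pose proof (coth_pseries _ Hu) as Hc.
replace (2 * (t / 2)) with t in Hc by field.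
replace (t / (exp t - 1)) with (t / (exp t - 1) + t / 2 + t * (- / 2)).
2:{ field. intros H. assert (t = 0) by (apply exp_inv; rewrite exp_0; lra).
    subst t; rewrite Rabs_R0 in Ht; lra. }
apply is_pseries_odd_even; apply is_pseries_R.
- apply is_pseries_R in Hc. eapply is_series_ext; [|exact Hc].
  intros n; cbv beta. unfold bernoulli_egf_coef.
  rewrite Nat.even_even. rewrite Nat.mul_comm, Nat.div_mul by lia.
  replace ((t / 2) ^ 2) with (t ^ 2 * / 4) by field.
  rewrite Rpow_mult_distr, pow_inv.
  match goal with |- ?a = ?b => change (@eq R a b) end. field. apply pow_nonzero; lra.
- replace (- / 2) with (- / 2 * 1) by ring.
  eapply is_series_ext; [|exact (is_series_scal_l (V := R_NormedModule) (- / 2) _ _ series_first)].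
  intros n. unfold scal; simpl scal; unfold mult; cbn -[pow Nat.mul Nat.div bernoulli_egf_coef].
  unfold bernoulli_egf_coef. rewrite Nat.even_odd.
  destruct n as [|n]; [simpl; ring|].
  destruct (Nat.eqb_spec (2 * S n + 1) 1); [lia|ring].
Qed.

(** Euler's formula: uniqueness identifies [B] with the computed coefficients, and the absolute
    value discards the alternating sign. *)
Lemma abs_bernoulli_even (B : nat -> R) (n : nat) :
  bernoulli_numbers B -> (1 <= n)%nat ->
  Rabs (B (2 * n)%nat) = 2 * / (4 * PI ^ 2) ^ n * INR (fact (2 * n)) * zeta (2 * n).
Proof.
intros HB Hn.
assert (HC : bernoulli_numbers (fun m => bernoulli_egf_coef m * INR (fact m))).
{ exists 1; split; [lra|]. intros t Ht.
  pose proof (bernoulli_egf t Ht) as H. apply is_pseries_R in H.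
  eapply is_series_ext; [|exact H]. intros m; cbv beta.
  match goal with |- ?a = ?b => change (@eq R a b) end. field. apply INR_fact_neq_0. }
rewrite (bernoulli_numbers_unique _ _ HB HC).
unfold bernoulli_egf_coef.
rewrite Nat.even_even. replace (2 * n / 2)%nat with n by (rewrite Nat.mul_comm, Nat.div_mul; lia).
unfold coth_coef, Rdiv. rewrite !Rabs_mult, pow_1_abs, Rmult_1_l.
pose proof PI_gt_3. pose proof (zeta_ge_1 (2 * n) ltac:(lia)).
assert (H4 : 0 < / 4 ^ n) by (apply Rinv_0_lt_compat, pow_lt; lra).
assert (HP : 0 < / PI ^ (2 * n)) by (apply Rinv_0_lt_compat, pow_lt; lra).
rewrite (Rabs_pos_eq (/ 4 ^ n)), (Rabs_pos_eq (INR _)) by (try apply pos_INR; lra).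
destruct n as [|n]; [lia|]. unfold cot_coef. rewrite Rabs_Ropp, Rabs_pos_eq.
- rewrite Rpow_mult_distr, <- pow_mult, Rinv_mult. unfold Rdiv. ring.
- unfold Rdiv. apply Rmult_le_pos; lra.
Qed.

Theorem theorem2p2 (B : nat -> R) (hB : bernoulli_numbers B) :
  infinitely_log_monotonic 1 (fun n : nat => Rabs (B (2 * n)%nat)).
Proof.
pose proof PI_gt_3 as HPI.
assert (Hc : 0 < 4 * PI ^ 2) by nra.
assert (Hc' : forall n, 0 < / (4 * PI ^ 2) ^ n)
  by (intros n; apply Rinv_0_lt_compat, pow_lt, Hc).
assert (Hf : forall n, 0 < INR (fact (2 * n))) by (intros n; apply lt_0_INR, lt_O_fact).
assert (Hz : forall n, (1 <= n)%nat -> 0 < zeta (2 * n)).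
{ intros n Hn; pose proof (zeta_ge_1 (2 * n) ltac:(lia)); lra. }
apply log_monotonic_of_alternating.
- intros n Hn. rewrite abs_bernoulli_even by assumption.
  specialize (Hc' n); specialize (Hf n); specialize (Hz n Hn).
  repeat apply Rmult_lt_0_compat; lra.
(* The logarithm of Euler's formula splits into an affine part, ln (2n)! and ln zeta(2n). *)
- apply alternating_ext with (fun n => (ln 2 + - ln (4 * PI ^ 2) * INR n)
    + ln (INR (fact (2 * n))) + ln (zeta (2 * n))).
  + intros n Hn. rewrite abs_bernoulli_even by assumption.
    specialize (Hc' n); specialize (Hf n); specialize (Hz n Hn).
    set (c := 4 * PI ^ 2) in *. clearbody c.
    assert (0 < 2 * / c ^ n) by lra.
    rewrite !ln_mult by (try apply Rmult_lt_0_compat; lra).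
    rewrite ln_Rinv, ln_pow by (exact Hc || apply pow_lt, Hc). ring.
  + apply (alternating_plus (fun n => (ln 2 + - ln (4 * PI ^ 2) * INR n)
      + ln (INR (fact (2 * n))))); [|exact alternating_ln_zeta].
    apply (alternating_plus (fun n => ln 2 + - ln (4 * PI ^ 2) * INR n));
      [apply alternating_affine|exact alternating_ln_fact].
Qed.
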